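(* Let $v$ be a smooth 1-homogeneous function on $\mathbb R^{n+1}_+=\{(x_0,x)\in\mathbb R\times\mathbb R^n:x_0>0\}$ that solves the differential equation $$dd^\#v\wedge\Omega=0,$$ where $\Omega$ is regular and strongly homogeneous of bidegree $(n-1,n-1)$ on $\mathbb R^{n+1}_+$, and $\Omega$ is strictly positive on $H_0=\{x_0=1\}$. Assume that $v$ extends smoothly to the boundary $\{x_0=0\}$ outside the origin, and that $v(0,x)=0$. Then $v=cx_0$ for some constant $c$.
   Context: A superform of bidegree $(p,q)$ on an open set $U\subset\mathbb R^{n+1}$ (coordinates $x_0,\dots,x_n$) is a form $\alpha=\sum_{|I|=p,|K|=q}\alpha_{IK}(x)\,dx_I\wedge d\xi_K$ on $U\times\mathbb R^{n+1}_\xi$ whose coefficients depend only on $x$; $d$ is the exterior derivative. For a function $\psi$, $dd^\#\psi=\sum_{j,k}\frac{\partial^2\psi}{\partial x_j\partial x_k}dx_j\wedge d\xi_k$. A function $v$ is 1-homogeneous if $v(tx)=tv(x)$ for $t>0$. A smooth form $\Omega$ of bidegree $(p,p)$ on $\mathbb R^{n+1}_+$ is strongly homogeneous if $d\Omega=0$ and $\delta^\#\Omega=0$, where $\delta^\#$ is contraction with $\sum_{j=0}^nx_j\,\partial/\partial\xi_j$; it is regular if it extends smoothly to the closure of $\mathbb R^{n+1}_+$ outside the origin. The restriction of $\Omega$ to $H_0\cong\mathbb R^n$ is obtained by setting $x_0=1$ and discarding all terms containing $dx_0$ or $d\xi_0$; it is an $(n-1,n-1)$-form on $\mathbb R^n$.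 Strict positivity of $\Omega$ on $H_0$ means that the coefficient matrix of this restriction is positive definite at every point, equivalently that $\Omega|_{H_0}\wedge a\wedge a^\#>0$ (a positive multiple of $dx_1\wedge d\xi_1\wedge\dots\wedge dx_n\wedge d\xi_n$) for every nonzero covector $a=\sum_{j=1}^na_jdx_j$, where $a^\#=\sum_{j=1}^na_jd\xi_j$. *)

(* Defs.v *)
From HB Require Import structures.
From mathcomp Require Import all_boot all_order all_algebra.
From mathcomp Require Import all_classical all_reals all_analysis.
Set Implicit Arguments.
Unset Strict Implicit.
Unset Printing Implicit Defensive.
Import Order.TTheory GRing.Theory Num.Theory.
Import numFieldNormedType.Exports.
Local Open Scope ring_scope.

(* The exterior algebra on the 2m anticommuting generators dx_j, dxi_k; the   *)
(* entry at (I, K) is the coefficient of dx_I /\ dxi_K, where the factors of  *)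
(* dx_I and of dxi_K are taken in increasing order of the indices.            *)
Notation bindex m := ({set 'I_m} * {set 'I_m})%type.
Notation supercov R m := {ffun bindex m -> R^o}.

Section ExteriorAlgebra.
Variables (R : realType) (m : nat).
Implicit Types (a b : supercov R m) (I K : {set 'I_m}).

Definition smonom I K : supercov R m := [ffun IK => ((IK == (I, K))%:R : R^o)].

Definition dx (j : 'I_m) : supercov R m := smonom [set j] finset.set0.
Definition dxi (k : 'I_m) : supercov R m := smonom finset.set0 [set k].

Definition inversions (A B : {set 'I_m}) : nat :=
  #|[set ij : 'I_m * 'I_m | [&& ij.1 \in A, ij.2 \in B & (ij.2 < ij.1)%N]]|.

(* (dx_I /\ dxi_K) /\ (dx_J /\ dxi_L)                                         *)
(*    = (-1)^(|K||J|) (dx_I /\ dx_J) /\ (dxi_K /\ dxi_L).                     *)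
Definition wedge_sign (I K J L : {set 'I_m}) : R :=
  (-1) ^+ (#|K| * #|J| + inversions I J + inversions K L)%N.

Definition wedge a b : supercov R m :=
  [ffun IK : bindex m =>
    (\sum_(I in powerset IK.1) \sum_(K in powerset IK.2)
     wedge_sign I K (IK.1 :\: I) (IK.2 :\: K)
       * a (I, K) * b (IK.1 :\: I, IK.2 :\: K) : R^o)].

(* Interior product with \sum_j w_j d/dxi_j, an antiderivation killing the    *)
(* dx_j: it meets the |I| factors of dx_I first, then those of dxi_K.         *)
Definition contract_xi (w : 'rV[R]_m) a : supercov R m :=
  [ffun IK : bindex m => (\sum_(j < m | j \notin IK.2)
     w 0 j * (-1) ^+ (#|IK.1| + inversions [set j] IK.2)%N
       * a (IK.1, j |: IK.2) : R^o)].

Definition covx (a : 'rV[R]_m) : supercov R m := \sum_(j < m) a 0 j *: dx j.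
Definition covxi (a : 'rV[R]_m) : supercov R m := \sum_(j < m) a 0 j *: dxi j.

Definition supervol : supercov R m :=
  \big[wedge/smonom finset.set0 finset.set0]_(j < m) wedge (dx j) (dxi j).

End ExteriorAlgebra.

Local Open Scope classical_set_scope.

(* Only the values on the open set under consideration are meaningful. *)
Definition superform (R : realType) (m : nat) : Type :=
  'rV[R]_m -> supercov R m.

Section Calculus.
Variables (R : realType) (m : nat).
Local Notation V := 'rV[R]_m.+1.

Definition partial (j : 'I_m.+1) (f : V -> R) : V -> R :=
  fun x => 'D_(delta_mx 0 j) f x.

Definition iter_partial (s : seq 'I_m.+1) (f : V -> R) : V -> R :=
  foldr partial f s.

(* C^infinity on U, for U open. *)
Definition smooth_on (U : set V) (f : V -> R) : Prop :=
  forall (s : seq 'I_m.+1) (x : V), U x ->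
    {for x, continuous (iter_partial s f)} /\
    (forall j, derivable (iter_partial s f) x (delta_mx 0 j)).

Definition coeff (a : superform R m.+1) (I K : {set 'I_m.+1}) : V -> R :=
  fun x => a x (I, K).

Definition smooth_form_on (U : set V) (a : superform R m.+1) : Prop :=
  forall I K, smooth_on U (coeff a I K).

Definition has_bidegree (p q : nat) (U : set V) (a : superform R m.+1) : Prop :=
  forall x (I K : {set 'I_m.+1}), U x ->
    ~ (#|I| = p /\ #|K| = q) -> coeff a I K x = 0.

Definition swedge (a b : superform R m.+1) : superform R m.+1 :=
  fun x => wedge (a x) (b x).

(* d a = \sum_j dx_j /\ (da/dx_j) *)
Definition extd (a : superform R m.+1) : superform R m.+1 :=
  fun x => \sum_(j < m.+1)
    wedge (dx R j)
      [ffun IK : bindex m.+1 => (partial j (coeff a IK.1 IK.2) x : R^o)].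

Definition ddsharp (psi : V -> R) : superform R m.+1 :=
  fun x => \sum_(j < m.+1) \sum_(k < m.+1)
    partial j (partial k psi) x *: wedge (dx R j) (dxi R k).

Definition deltasharp (a : superform R m.+1) : superform R m.+1 :=
  fun x => contract_xi x (a x).

Definition vanishes_on (U : set V) (a : superform R m.+1) : Prop :=
  forall x, U x -> a x = 0.

End Calculus.

Section HalfSpace.
Variables (R : realType) (n : nat).
Local Notation V := 'rV[R]_n.+1.

Definition halfspace : set V := [set x | 0 < x 0 ord0].

Definition homogeneous1 (v : V -> R) : Prop :=
  forall (t : R) (x : V), 0 < t -> halfspace x -> v (t *: x) = t * v x.

(* g is a smooth extension of f to the closed half space minus the origin;    *)
(* smoothness at boundary points is smoothness on an open neighbourhood.      *)
Definition smooth_extension (f g : V -> R) : Prop :=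
  exists W : set V,
    [/\ open W, closure halfspace `\ 0 `<=` W, smooth_on W g
      & forall x, halfspace x -> g x = f x].

Definition regular_form (Omega : superform R n.+1) : Prop :=
  forall I K, exists g : V -> R, smooth_extension (coeff Omega I K) g.

Definition strongly_homogeneous (p : nat) (Omega : superform R n.+1) : Prop :=
  [/\ smooth_form_on halfspace Omega,
      has_bidegree p p halfspace Omega,
      vanishes_on halfspace (extd Omega)
    & vanishes_on halfspace (deltasharp Omega)].

(* Pull-back to {x_0 = 1}: index j of R^n is index j + 1 of R^(n+1). *)
Definition restrict_H0 (Omega : superform R n.+1) : superform R n :=
  fun y => [ffun IK : bindex n =>
    Omega (row_mx (1%:M : 'M[R]_1) y : 'rV[R]_(1 + n))
      (lift ord0 @: IK.1, lift ord0 @: IK.2)].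

Definition strictly_positive_H0 (Omega : superform R n.+1) : Prop :=
  forall (y a : 'rV[R]_n), a != 0 ->
    exists2 c : R, 0 < c &
      wedge (wedge (restrict_H0 Omega y) (covx a)) (covxi a)
        = c *: supervol R n.

End HalfSpace.

(* Main.v *)
(* Write Omega as a tensor T^{ij,kl}, antisymmetric in (i,j) and in (k,l). The
   condition delta^# Omega = 0 reads x_m T^{ij,kl} + cyclic(k,l,m) = 0, and its
   divergence over i, by d Omega = 0, is the first Bianchi identity. Hence
   T^{ij,kl} = T^{kl,ij}; the same computation on the first pair of indices then
   gives Euler's relation, so T is homogeneous of degree 1 - n.

   On x_0 = 1 the matrix A = T^{0j,0k} is definite and divergence free, and the
   equation is sum A_jk v_jk = 0, so that the flux F = v A dv has divergence
   sum A_jk v_j v_k >= 0. Since w vanishes on {x_0 = 0}, v is bounded and dv is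
   O(1/L) on the boundary of the cube of size L, where A is O(L^(1-n)): the flux
   through the boundary is O(1/L), which forces dv = 0 on x_0 = 1. The divergence
   theorem is replaced by Riemann sums over a grid, which telescope. *)
Require Import Defs.
From HB Require Import structures.
From mathcomp Require Import all_boot all_order all_algebra.
From mathcomp Require Import all_classical all_reals all_analysis.
From mathcomp Require Import ring lra.
Import Order.TTheory GRing.Theory Num.Theory.
Import numFieldNormedType.Exports.
Local Open Scope ring_scope.

(** * Exterior algebra *)

Section Wedge.
Import mathcomp.boot.finset.
Variables (R : realType) (m : nat).
Implicit Types (a b : supercov R m) (A B I K : {set 'I_m}).

Lemma wedge_smonoml A B b I K : wedge (smonom R A B) b (I, K) =
  if (A \subset I) && (B \subset K)
  then wedge_sign R A B (I :\: A) (K :\: B) * b (I :\: A, K :\: B) else 0.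
Proof.
rewrite ffunE /=; case: ifP => [/andP[AI BK]|AB].
  rewrite (bigD1 A) ?powersetE //= [X in _ + X]big1 ?addr0; last first.
    move=> I' /andP[_ I'A]; apply: big1 => K' _.
    by rewrite ffunE xpair_eqE (negbTE I'A) mulr0 mul0r.
  rewrite (bigD1 B) ?powersetE //= big1 ?addr0 => [|K' /andP[_ K'B]].
    by rewrite ffunE eqxx mulr1.
  by rewrite ffunE xpair_eqE (negbTE K'B) andbF mulr0 mul0r.
apply: big1 => I'; rewrite powersetE => I'I; apply: big1 => K'; rewrite powersetE => K'K.
rewrite ffunE xpair_eqE; case: eqP => [I'A|]; last by rewrite mulr0 mul0r.
case: eqP => [K'B|]; last by rewrite mulr0 mul0r.
by move: AB; rewrite -I'A -K'B I'I K'K.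
Qed.

Lemma wedge_smonomr A B a I K : wedge a (smonom R A B) (I, K) =
  if (A \subset I) && (B \subset K)
  then wedge_sign R (I :\: A) (K :\: B) A B * a (I :\: A, K :\: B) else 0.
Proof.
have DD (X Y : {set 'I_m}) : Y \subset X -> X :\: (X :\: Y) = Y.
  by move=> YX; rewrite setDDr setDv set0U; apply/setIidPr.
rewrite ffunE /=; case: ifP => [/andP[AI BK]|AB].
  rewrite (bigD1 (I :\: A)) ?powersetE ?subsetDl //= [X in _ + X]big1 ?addr0; last first.
    move=> I' /andP[I'I I'A]; apply: big1 => K' _; rewrite ffunE xpair_eqE.
    rewrite powersetE in I'I; case: eqP => [E|]; last by rewrite mulr0.
    by move: I'A; rewrite -E DD // eqxx.
  rewrite (bigD1 (K :\: B)) ?powersetE ?subsetDl //= big1 ?addr0 => [|K' /andP[K'K K'B]].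
    by rewrite ffunE !DD // eqxx mulr1.
  rewrite powersetE in K'K; rewrite ffunE xpair_eqE andbC.
  case: eqP => [E|]; last by rewrite mulr0.
  by move: K'B; rewrite -E DD // eqxx.
apply: big1 => I' _; apply: big1 => K' _; rewrite ffunE xpair_eqE.
case: eqP => [E|]; last by rewrite mulr0.
case: eqP => [E'|]; last by rewrite mulr0.
by move: AB; rewrite -E -E' !subsetDl.
Qed.

Lemma wedge_suml (J : finType) (c : J -> R) (f : J -> supercov R m) b :
  wedge (\sum_i c i *: f i) b = \sum_i c i *: wedge (f i) b.
Proof.
apply/ffunP => -[I K]; rewrite sum_ffunE ffunE /=.
under [RHS]eq_bigr do rewrite !ffunE /= scaler_sumr.
rewrite [RHS]exchange_big /=; apply: eq_bigr => I' _.
under [RHS]eq_bigr do rewrite scaler_sumr.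
rewrite [RHS]exchange_big /=; apply: eq_bigr => K' _.
rewrite sum_ffunE mulr_sumr mulr_suml; apply: eq_bigr => i _.
by rewrite ffunE /GRing.scale /=; ring.
Qed.

Lemma wedge_sumr (J : finType) (c : J -> R) (f : J -> supercov R m) a :
  wedge a (\sum_i c i *: f i) = \sum_i c i *: wedge a (f i).
Proof.
apply/ffunP => -[I K]; rewrite sum_ffunE ffunE /=.
under [RHS]eq_bigr do rewrite !ffunE /= scaler_sumr.
rewrite [RHS]exchange_big /=; apply: eq_bigr => I' _.
under [RHS]eq_bigr do rewrite scaler_sumr.
rewrite [RHS]exchange_big /=; apply: eq_bigr => K' _.
rewrite sum_ffunE mulr_sumr; apply: eq_bigr => i _.
by rewrite ffunE /GRing.scale /=; ring.
Qed.

Lemma inversions0l A : inversions set0 A = 0%N.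
Proof. by apply: eq_card0 => -[i j]; rewrite !inE. Qed.

Lemma inversions0r A : inversions A set0 = 0%N.
Proof. by apply: eq_card0 => -[i j]; rewrite !inE andbF. Qed.

Lemma inversions1l j A : inversions [set j] A = #|[set a in A | (a < j)%N]|.
Proof.
have jI : injective (fun a : 'I_m => (j, a)) by move=> a b [].
rewrite /inversions -(card_imset _ jI).
apply: eq_card => -[a b]; rewrite !inE /=; apply/idP/imsetP => [/and3P[/eqP-> bA bj]|].
  by exists b; rewrite ?inE ?bA.
by move=> [c]; rewrite inE => /andP[cA cj] [-> ->]; rewrite eqxx cA.
Qed.

Lemma inversions1r A k : inversions A [set k] = #|[set a in A | (k < a)%N]|.
Proof.
have kI : injective (fun a : 'I_m => (a, k)) by move=> a b [].
rewrite /inversions -(card_imset _ kI).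
apply: eq_card => -[a b]; rewrite !inE /=; apply/idP/imsetP => [/and3P[aA /eqP-> ka]|].
  by exists a; rewrite ?inE ?aA.
by move=> [c]; rewrite inE => /andP[cA kc] [-> ->]; rewrite eqxx cA.
Qed.

Lemma card_ltn_ord (j : 'I_m) : #|[set a : 'I_m | (a < j)%N]| = j.
Proof.
have wI : injective (widen_ord (ltnW (ltn_ord j))) by move=> a b /(congr1 val) /= /val_inj.
rewrite -[RHS]card_ord -(card_imset _ wI); apply: eq_card => a; rewrite inE.
apply/idP/imsetP => [aj|[b _ ->]]; last exact: (ltn_ord b).
by exists (Ordinal aj) => //; apply: val_inj.
Qed.

Lemma card_below_setC (S : {set 'I_m}) (j : 'I_m) :
  (#|[set a in ~: S | (a < j)%N]| + #|[set a in S | (a < j)%N]| = j)%N.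
Proof.
rewrite -[RHS]card_ltn_ord -[RHS](cardsID S) addnC; congr (_ + _)%N.
  by apply: eq_card => a; rewrite !inE andbC.
by apply: eq_card => a; rewrite !inE andbC.
Qed.

Lemma smonom_wedge A B A' B' : wedge (smonom R A B) (smonom R A' B') =
  if [disjoint A & A'] && [disjoint B & B']
  then wedge_sign R A B A' B' *: smonom R (A :|: A') (B :|: B') else 0.
Proof.
apply/ffunP => -[I K]; rewrite wedge_smonoml ffunE xpair_eqE.
have E (X Y Z : {set 'I_m}) :
    (X \subset Z) && (Z :\: X == Y) = [disjoint X & Y] && (Z == X :|: Y).
  apply/andP/andP => [[XZ /eqP <-]|[XY /eqP ->]].
    rewrite -setI_eq0 setIDA setDIl setDv set0I; split=> //.
    by rewrite -[X in X :|: _](setIidPr XZ) setID.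
  by rewrite subsetUl setDUl setDv set0U; split=> //; apply/eqP/setDidPl; rewrite disjoint_sym.
case: ifP => [/andP[AI BK]|nAB].
  move: (E A A' I) (E B B' K); rewrite AI BK /=.
  case: (eqVneq (I :\: A) A') => [->|_] /esym.
    move=> /andP[-> /eqP ->].
    case: (eqVneq (K :\: B) B') => [->|_] /esym.
      by move=> /andP[-> /eqP ->]; rewrite /= ffunE /= ffunE eqxx.
    rewrite mulr0 /=; case: ifP => _ /= E'; last by rewrite ffunE.
    by rewrite !ffunE xpair_eqE E' andbF /GRing.scale /= mulr0.
  rewrite mulr0; case: ifP => /= [/andP[-> ->] /= E' _|_ _ _]; last by rewrite ffunE.
  by rewrite !ffunE xpair_eqE E' /GRing.scale /= mulr0.
case: ifP => [/andP[d d']|]; rewrite !ffunE // xpair_eqE.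
move: (E A A' I) (E B B' K) nAB; rewrite d d' /= => <- <-.
by case: (A \subset I); case: (B \subset K) => //= _; rewrite ?andbF /GRing.scale /= mulr0.
Qed.

Lemma wedge_dx_dxi (j k : 'I_m) : wedge (dx R j) (dxi R k) = smonom R [set j] [set k].
Proof.
rewrite smonom_wedge /wedge_sign -setI_eq0 setI0 -setI_eq0 set0I eqxx /=.
by rewrite cards0 muln0 inversions0r inversions0l expr0 scale1r setU0 set0U.
Qed.

Lemma supervol_setT : exists b : bool, supervol R m (setT, setT) = (-1) ^+ b.
Proof.
suff H (r : seq 'I_m) : uniq r -> exists b : bool,
    \big[@wedge R m/smonom R set0 set0]_(j <- r) wedge (dx R j) (dxi R j) =
    (-1) ^+ b *: smonom R [set j in r] [set j in r].
  have [b E] := H _ (index_enum_uniq 'I_m); exists b; rewrite /supervol E.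
  have -> : [set j in index_enum 'I_m] = setT.
    by apply/setP => j; rewrite !inE mem_index_enum.
  by rewrite !ffunE eqxx /GRing.scale /= mulr1.
elim: r => [_|j r IH /= /andP[jr /IH[b E]]].
  exists false; rewrite big_nil expr0 scale1r; congr smonom; apply/setP => j; by rewrite !inE.
rewrite big_cons E wedge_dx_dxi.
set S := [set j0 in r]; set J := [set j].
have -> : wedge (smonom R J J) ((-1) ^+ b *: smonom R S S) =
    (-1) ^+ b *: wedge (smonom R J J) (smonom R S S).
  have := @wedge_sumr 'I_1 (fun=> (-1) ^+ b) (fun=> smonom R S S) (smonom R J J).
  by rewrite !big_ord1.
rewrite smonom_wedge disjoints1 inE jr /= scalerA /wedge_sign -exprD.
exists (odd (b + (#|J| * #|S| + inversions J S + inversions J S))).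
by rewrite signr_odd set_cons.
Qed.

End Wedge.

Section Dual.
Import mathcomp.boot.finset.
Variables (R : realType) (m : nat).
Implicit Types (X : supercov R m) (I K : {set 'I_m}) (i j k l p : 'I_m).

Definition ord_sign i j : R := if (i < j)%N then 1 else if (j < i)%N then -1 else 0.
Definition cut_sign i j : R := (-1) ^+ (i + j)%N * ord_sign i j.

(* The coefficients of an (m-2,m-2)-form, indexed by the pairs of missing dx and
   dxi and signed so as to be antisymmetric in (i,j) and in (k,l). *)
Definition dual X i j k l : R :=
  cut_sign i j * cut_sign k l * X (~: [set i; j], ~: [set k; l]).

Lemma ord_signC i j : ord_sign j i = - ord_sign i j.
Proof. by rewrite /ord_sign; case: ltngtP; rewrite ?opprK ?oppr0. Qed.

Lemma ord_sign_neq i j : i != j -> ord_sign i j = (-1) ^+ (j < i)%N.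
Proof.
rewrite -val_eqE /ord_sign /=; case: ltngtP => //.
Qed.

Lemma ord_sign_sqr i j : i != j -> ord_sign i j * ord_sign i j = 1.
Proof. by move=> ij; rewrite ord_sign_neq // -expr2 sqrr_sign. Qed.

Lemma cut_signC i j : cut_sign j i = - cut_sign i j.
Proof. by rewrite /cut_sign ord_signC mulrN addnC. Qed.

Lemma cut_signii i : cut_sign i i = 0.
Proof. by rewrite /cut_sign /ord_sign ltnn mulr0. Qed.

Lemma dual_antisyml X i j k l : dual X j i k l = - dual X i j k l.
Proof. by rewrite /dual cut_signC setUC !mulNr. Qed.

Lemma dual_antisymr X i j k l : dual X i j l k = - dual X i j k l.
Proof. by rewrite /dual (cut_signC k l) [[set l] :|: _]setUC mulrN mulNr. Qed.

Lemma dual_diagl X i k l : dual X i i k l = 0.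
Proof. by rewrite /dual cut_signii !mul0r. Qed.

Lemma dual_diagr X i j k : dual X i j k k = 0.
Proof. by rewrite /dual cut_signii mulr0 mul0r. Qed.

Lemma inversions_cut2 i j : i != j ->
  (-1) ^+ inversions [set i] (~: [set i; j]) = (-1) ^+ i * ord_sign i j.
Proof.
move=> ij; rewrite inversions1l ord_sign_neq //.
have := card_below_setC _ [set i; j] i.
have -> : [set a in [set i; j] | (a < i)%N] = if (j < i)%N then [set j] else set0.
  apply/setP => a; rewrite !inE; case: (ltnP j i) => [ji|ij']; rewrite !inE.
    by case: (eqVneq a i) => [->|_] /=; [rewrite ltnn (negbTE ij)|case: eqP => [->|]].
  by case: (eqVneq a i) => [->|_] /=; [rewrite ltnn|case: eqP => [->|//]; rewrite ltnNge ij'].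
move=> E; rewrite -[X in _ = _ ^+ X * _]E exprD -mulrA -exprD -[LHS]mulr1; congr (_ * _).
by case: ltnP => _; rewrite ?cards1 ?cards0 -signr_odd.
Qed.

Lemma inversions_cut3 i j k : i != j -> i != k -> j != k ->
  (-1) ^+ inversions [set i] (~: [set i; j; k]) = (-1) ^+ i * (ord_sign i j * ord_sign i k).
Proof.
move=> ij ik jk; rewrite inversions1l !ord_sign_neq // -exprD.
have := card_below_setC _ [set i; j; k] i.
have -> : #|[set a in [set i; j; k] | (a < i)%N]| = ((j < i) + (k < i))%N.
  have -> : [set a in [set i; j; k] | (a < i)%N] =
      (if (j < i)%N then [set j] else set0) :|: (if (k < i)%N then [set k] else set0).
    apply/setP => a; rewrite 3!inE [RHS]inE.
    have E (c : 'I_m) : a \in (if (c < i)%N then [set c] else set0) = (a == c) && (a < i)%N.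
      have [->|ac] := eqVneq a c; first by case: ifP; rewrite !inE ?eqxx.
      by case: ifP; rewrite !inE // (negbTE ac).
    by rewrite !E !inE; case: (eqVneq a i) => [->|_] /=; rewrite ?ltnn ?andbF // andb_orl.
  case: (ltnP j i) => _; case: (ltnP k i) => _; rewrite ?setU0 ?set0U ?cards1 ?cards0 //.
  by rewrite cards2 jk.
move=> E; rewrite -[X in _ = _ ^+ X * _]E exprD -mulrA -exprD -[LHS]mulr1.
by rewrite addnn -[X in _ = _ * X]signr_odd odd_double.
Qed.

Lemma extd_dual (b : 'I_m -> supercov R m) j K :
  (\sum_i wedge (dx R i) (b i)) (~: [set j], K) =
  (-1) ^+ j * \sum_i cut_sign i j * b i (~: [set i; j], K).
Proof.
rewrite sum_ffunE mulr_sumr; apply: eq_bigr => i _.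
rewrite wedge_smonoml sub0set andbT setD0 sub1set !inE.
have [->|ij] := eqVneq i j; first by rewrite cut_signii mul0r mulr0.
rewrite /=.
have -> : ~: [set j] :\ i = ~: [set i; j] by rewrite setCU setIC setDE.
rewrite /wedge_sign cards0 mul0n inversions0l addn0 add0n inversions_cut2 // /cut_sign exprD.
by rewrite [_ ^+ i * _ ^+ j]mulrC !mulrA -expr2 sqrr_sign mul1r.
Qed.

Lemma contract_dual (w : 'rV[R]_m) X i j k l p : contract_xi w X = 0 ->
  w 0 p * dual X i j k l + w 0 k * dual X i j l p + w 0 l * dual X i j p k = 0.
Proof.
move=> X0.
have [->|kl] := eqVneq k l; first by rewrite dual_diagr (dual_antisymr _ _ _ l p); ring.
have [->|kp] := eqVneq k p; first by rewrite dual_diagr (dual_antisymr _ _ _ l p); ring.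
have [->|lp] := eqVneq l p; first by rewrite dual_diagr (dual_antisymr _ _ _ k p); ring.
have := congr1 (fun f : supercov R m => f (~: [set i; j], ~: [set k; l; p])) X0.
rewrite !ffunE /= (eq_bigl (fun q => q \in [set k; l; p])) => [|q]; last by rewrite !inE negbK.
rewrite -setUA big_setU1 ?inE ?negb_or ?kl //= big_setU1 ?inE //= big_set1.
rewrite setUA !exprD.
have E a b c : a \notin [set b; c] -> a |: ~: [set a; b; c] = ~: [set b; c].
  move=> abc; apply/setP => q; rewrite !inE; case: (eqVneq q a) => [->|] //=.
  by move: abc; rewrite !inE => ->.
have P1 : [set k; l; p] = [set l; p; k] by rewrite -setUA setUC.
have P2 : [set k; l; p] = [set p; k; l] by rewrite setUC setUA.
rewrite E ?inE ?negb_or ?kl // inversions_cut3 //.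
rewrite P1 E ?inE ?negb_or ?lp 1?eq_sym // inversions_cut3 // 1?eq_sym //.
rewrite -P1 P2 E ?inE ?negb_or ?(eq_sym p) ?kp // inversions_cut3 // 1?eq_sym //.
rewrite /dual /cut_sign !exprD (ord_signC p k) (ord_signC k l) (ord_signC l p).
have pk : p != k by rewrite eq_sym.
move: (ord_sign_sqr _ _ kl) (ord_sign_sqr _ _ lp) (ord_sign_sqr _ _ pk).
set a := ord_sign k l; set b := ord_sign l p; set c := ord_sign p k => a1 b1 c1.
have sq q : (-1) ^+ q * (-1) ^+ q = 1 :> R by rewrite -expr2 sqrr_sign.
move: (sq k) (sq l) (sq p) (sq #|~: [set i; j]|).
set uk := _ ^+ k; set ul := _ ^+ l; set up := _ ^+ p; set s := _ ^+ #|_| => k1 l1 p1 s1.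
set e := _ ^+ i * _ ^+ j * _; set Xlp := X (_, ~: [set l; p]).
set Xpk := X (_, ~: [set p; k]); set Xkl := X (_, ~: [set k; l]) => H.
pose f := - (e * s * (uk * ul * up) * (a * b * c)).
have aux (W u v t x y z Y : R) : u * u = 1 -> x * x = 1 -> z * z = 1 ->
    W * (e * (v * t * y) * Y) =
    - (e * s * (u * v * t) * (x * y * z)) * (W * (s * (u * (x * - z))) * Y).
  move=> u1 x1 z1; transitivity
    ((s * s) * (u * u) * (x * x) * (z * z) * (W * (e * (v * t * y) * Y))).
    by rewrite s1 u1 x1 z1 !mul1r.
  by ring.
rewrite (aux (w 0 p) up uk ul c a b) // (aux (w 0 k) uk ul up a b c) //.
rewrite (aux (w 0 l) ul up uk b c a) // -[RHS](mulr0 f) -H /f; ring.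
Qed.

Lemma wedge_dual (c : 'I_m -> 'I_m -> R) X p :
  wedge (\sum_j \sum_k c j k *: wedge (dx R j) (dxi R k)) X (~: [set p], ~: [set p]) =
  (-1) ^+ m * \sum_j \sum_k c j k * dual X p j p k.
Proof.
have -> : \sum_j \sum_k c j k *: wedge (dx R j) (dxi R k) =
    \sum_(u : 'I_m * 'I_m) c u.1 u.2 *: smonom R [set u.1] [set u.2].
  by rewrite pair_bigA; apply: eq_bigr => u _; rewrite wedge_dx_dxi.
rewrite wedge_suml sum_ffunE pair_bigA mulr_sumr; apply: eq_bigr => -[j k] _ /=.
rewrite ffunE wedge_smonoml !sub1set !inE /dual.
have [->|jp] := eqVneq j p; first by rewrite cut_signii !mul0r !mulr0 scaler0.
have [->|kp] := eqVneq k p; first by rewrite cut_signii !(mulr0, mul0r) scaler0.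
have D q : ~: [set p] :\ q = ~: [set q; p] by rewrite setCU setIC setDE.
have := cardsC [set j; p]; rewrite cards2 jp card_ord /= => Em.
have {}Em : (-1) ^+ m = (-1) ^+ #|~: [set j; p]| :> R.
  have := congr1 (fun q : nat => (-1) ^+ q : R) Em.
  by rewrite exprD sqrrN expr1n mul1r.
rewrite !D /wedge_sign cards1 mul1n !exprD !inversions_cut2 // Em.
rewrite ![[set p; _]]setUC /cut_sign !exprD (ord_signC p j) (ord_signC p k) /GRing.scale /=.
have P : (-1) ^+ p * (-1) ^+ p = 1 :> R by rewrite -expr2 sqrr_sign.
set X' := X _; set s := _ ^+ #|_|; set u := _ ^+ j; set v := _ ^+ k.
transitivity (((-1) ^+ p * (-1) ^+ p) *
  (c j k * (s * (u * - ord_sign p j) * (v * - ord_sign p k) * X'))).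
  by rewrite P mul1r.
by rewrite /X' /s; ring.
Qed.

End Dual.
Arguments dual {R m}.
Arguments cut_sign R {m}.

Section TopDegree.
Import mathcomp.boot.finset.
Variables (R : realType) (n : nat).

Lemma sign_card_above (k : 'I_n) :
  (-1) ^+ #|[set a in [set~ k] | (k < a)%N]| = (-1) ^+ n.-1 * (-1) ^+ k :> R.
Proof.
have : (#|[set a in [set~ k] | (k < a)%N]| + k = n.-1)%N.
  have := cardsC1 k; rewrite card_ord => <-.
  rewrite -[X in (_ + X)%N]card_ltn_ord addnC -[RHS](cardsID [set a : 'I_n | (a < k)%N]).
  congr (_ + _)%N; apply: eq_card => a; rewrite !inE -val_eqE /=; case: ltngtP => //.
by move=> <-; rewrite exprD -mulrA -expr2 sqrr_sign mulr1.
Qed.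

Lemma wedge_covx_covxi (Y : supercov R n) (a : 'rV[R]_n) : 
  wedge (wedge Y (covx a)) (covxi a) (setT, setT) =
  (-1) ^+ n.-1 * \sum_j \sum_k a 0 j * a 0 k *
    ((-1) ^+ (j + k) * Y (~: [set j], ~: [set k])).
Proof.
rewrite /covxi wedge_sumr sum_ffunE exchange_big mulr_sumr; apply: eq_bigr => k _ /=.
rewrite ffunE wedge_smonomr sub0set subsetT setD0 /= /covx wedge_sumr sum_ffunE.
rewrite /GRing.scale /= !mulr_sumr; apply: eq_bigr => j _.
rewrite ffunE wedge_smonomr subsetT sub0set setD0 /= !setTD /GRing.scale /=.
rewrite /wedge_sign !cards0 !cards1 muln0 muln1 !inversions0r !inversions1r addn0 !add0n.
rewrite addn0 !exprD !sign_card_above cardsC1 card_ord.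
have S : (-1) ^+ n.-1 * (-1) ^+ n.-1 = 1 :> R by rewrite -expr2 sqrr_sign.
set s := _ ^+ n.-1; set u := _ ^+ j; set v := _ ^+ k; set y := Y _.
transitivity ((s * s) * (s * (a 0 j * a 0 k * (u * v * y)))); last by rewrite S mul1r.
by rewrite /y /s; ring.
Qed.

End TopDegree.

Section Restriction.
Import mathcomp.boot.finset.
Variables (R : realType) (n : nat).

Lemma restrict_dual (Om : superform R n.+1) (y : 'rV[R]_n) (j k : 'I_n) :
  (-1) ^+ (j + k) * restrict_H0 Om y (~: [set j], ~: [set k]) =
  dual (Om (row_mx (1%:M : 'M[R]_1) y : 'rV[R]_(1 + n)))
    ord0 (lift ord0 j) ord0 (lift ord0 k).
Proof.
rewrite ffunE /= /dual /cut_sign /ord_sign /= /bump /= !add1n !add0n !mulr1 !exprS.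
have L (i : 'I_n) : lift ord0 @: (~: [set i]) = ~: [set ord0; lift ord0 i].
  apply/setP => q; rewrite !inE; case: (unliftP ord0 q) => [l ->|->].
    rewrite mem_imset; last exact: lift_inj.
    by rewrite !inE (inj_eq lift_inj).
  apply/imsetP => -[l _] /eqP; by rewrite (negbTE (neq_lift _ _)).
by rewrite !L exprD; ring.
Qed.

Lemma strictly_positive_dual (Om : superform R n.+1) : strictly_positive_H0 Om ->
  exists b : bool, forall (y a : 'rV[R]_n), a != 0 ->
    0 < \sum_j \sum_k a 0 j * a 0 k * ((-1) ^+ b *
      dual (Om (row_mx (1%:M : 'M[R]_1) y : 'rV[R]_(1 + n)))
        ord0 (lift ord0 j) ord0 (lift ord0 k)).
Proof.
move=> pos; have [s Es] := supervol_setT R n.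
have [b Eb] : exists b : bool, forall (Y : supercov R n) (a : 'rV[R]_n),
  wedge (wedge Y (covx a)) (covxi a) (setT, setT) =
  (-1) ^+ b * \sum_j \sum_k a 0 j * a 0 k *
    ((-1) ^+ (j + k) * Y (~: [set j], ~: [set k])).
  by exists (odd n.-1) => Y a; rewrite wedge_covx_covxi signr_odd.
exists (s (+) b) => y a a0; have [c c0] := pos y a a0.
move=> /(congr1 (fun f : supercov R n => f (setT, setT))).
rewrite Eb ffunE Es /GRing.scale /= => E.
under eq_bigr do under eq_bigr do rewrite mulrCA.
under eq_bigr do rewrite -mulr_sumr.
rewrite -mulr_sumr.
suff -> : \sum_j \sum_k a 0 j * a 0 k *
      dual (Om (row_mx (1%:M : 'M[R]_1) y : 'rV[R]_(1 + n)))
        ord0 (lift ord0 j) ord0 (lift ord0 k) = (-1) ^+ b * (c * (-1) ^+ s).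
  rewrite signr_addb; move: c0; case: (s); case: (b); rewrite ?expr0 ?expr1; lra.
rewrite -E mulrA -expr2 sqrr_sign mul1r.
by apply: eq_bigr => j _; apply: eq_bigr => k _; rewrite restrict_dual.
Qed.

End Restriction.

Local Open Scope classical_set_scope.
Local Open Scope ring_scope.

(** * Calculus *)

Section DirectionalDerivatives.
Variables (R : realType) (V : normedModType R).
Implicit Types (f : V -> R) (x u e : V).

Lemma is_derive_line f x u (s : R) : derivable f (x + s *: u) u ->
  is_derive s (1 : R) (fun s => f (x + s *: u)) ('D_u f (x + s *: u)).
Proof.
have E : (fun h : R => h^-1 *: (((fun s => f (x + s *: u)) \o shift s) (h *: 1)
    - f (x + s *: u))) =
  (fun h => h^-1 *: ((f \o shift (x + s *: u)) (h *: u) - f (x + s *: u))).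
  apply/funext => h /=; congr (_ *: (f _ - _)).
  by rewrite [h *: 1]mulr1 scalerDl addrCA.
by move=> df; split; rewrite /derivable /derive E.
Qed.

Lemma mean_value_line f x u (a : R) :
  (forall t, 0 <= t <= 1 -> derivable f (x + (t * a) *: u) u) ->
  exists2 t, 0 <= t <= 1 & f (x + a *: u) - f x = a * 'D_u f (x + (t * a) *: u).
Proof.
move=> df; have [->|aN0] := eqVneq a 0.
  by exists 0; rewrite ?lexx ?ler01 // scale0r addr0 subrr mul0r.
have d s : 0 <= s / a <= 1 ->
    is_derive s (1 : R) (fun s => f (x + s *: u)) ('D_u f (x + s *: u)).
  by move=> /df; rewrite (divfK aN0 s); exact: is_derive_line.
have [a0|a0] := leP 0 a.
  have I s : 0 <= s <= a -> 0 <= s / a <= 1.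
    move=> /andP[s0 sa]; have a1 : 0 < a by rewrite lt_def aN0.
    by rewrite divr_ge0 //= ler_pdivrMr // mul1r.
  have [||s] := @MVT_segment _ (fun s => f (x + s *: u))
    (fun s => 'D_u f (x + s *: u)) 0 a a0.
  - move=> s; rewrite in_itv /= => /andP[/ltW s0 /ltW sa]; apply/d/I.
    by rewrite s0.
  - apply: derivable_within_continuous => s; rewrite in_itv /= => sI.
    by apply: ex_derive; apply/d/I.
  rewrite in_itv /= => sI; rewrite scale0r addr0 subr0 mulrC => E.
  by exists (s / a); [exact: I|rewrite divfK].
have I s : a <= s <= 0 -> 0 <= s / a <= 1.
  move=> /andP[sa s0]; rewrite ler_ndivrMr // mul1r sa andbT.
  by rewrite mulr_le0 // invr_le0 ltW.
have [||s] := @MVT_segment _ (fun s => f (x + s *: u))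
  (fun s => 'D_u f (x + s *: u)) a 0 (ltW a0).
- move=> s; rewrite in_itv /= => /andP[/ltW sa /ltW s0]; apply/d/I.
  by rewrite sa.
- apply: derivable_within_continuous => s; rewrite in_itv /= => sI.
  by apply: ex_derive; apply/d/I.
rewrite in_itv /= => sI; rewrite scale0r addr0 sub0r mulrC => E.
exists (s / a); first exact: I.
by rewrite divfK //; apply: oppr_inj; rewrite opprB E mulNr.
Qed.

Lemma derivable_add f x u e (a : R) :
  (\forall y \near x, derivable f y e) -> {for x, continuous ('D_e f)} ->
  derivable f x u -> is_derive x (u + a *: e) f ('D_u f x + a * 'D_e f x).
Proof.
move=> de ce du.
suff C : h^-1 *: ((f \o shift x) (h *: (u + a *: e)) - f x) @[h --> 0^'] -->
    'D_u f x + a * 'D_e f x.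
  by split; [apply/cvg_ex; eexists; exact: C | exact: cvg_lim C].
pose g (h : R) := h^-1 *: (f (h *: u + x + (h * a) *: e) - f (h *: u + x)).
have -> : (fun h : R => h^-1 *: ((f \o shift x) (h *: (u + a *: e)) - f x)) =
  (fun h => h^-1 *: ((f \o shift x) (h *: u) - f x)) \+ g.
  apply/funext => h; rewrite /g /= -scalerDr [X in _ = _ *: X]addrC subrKA.
  congr (_ *: (f _ - _)).
  by rewrite scalerDr scalerA addrAC.
apply: cvgD => //.
apply/cvgrPdist_lt => eps eps0.
have A0 : 0 < `|a| + 1 by rewrite ltr_wpDl.
have /cvgrPdist_lt := ce; move=> /(_ (eps / (`|a| + 1))) /(_ (divr_gt0 eps0 A0)).
move=> /(filterI de)/nbhs_ballP[r /= r0 xr].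
have B0 : 0 < `|u| + `|a| * `|e| + 1 by rewrite ltr_wpDl // addr_ge0 // mulr_ge0.
have key (h s : R) : `|h| < r / (`|u| + `|a| * `|e| + 1) -> `|s| <= `|h * a| ->
    ball x r (h *: u + x + s *: e).
  move=> hr sa; rewrite -ball_normE /= addrAC opprD addrCA subrr addr0 normrN.
  apply: le_lt_trans (ler_normD _ _) _; rewrite !normrZ.
  have : `|s| * `|e| <= `|h| * (`|a| * `|e|).
    by rewrite mulrA -normrM ler_wpM2r.
  rewrite ltr_pdivlMr // in hr; move: hr (normr_ge0 h); lra.
near=> h.
have hr : `|h| < r / (`|u| + `|a| * `|e| + 1).
  near: h; apply: dnbhs0_lt; exact: divr_gt0.
have h0 : h != 0 by near: h; exact: nbhs_dnbhs_neq.
have sle (t : R) : 0 <= t <= 1 -> `|t * (h * a)| <= `|h * a|.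
  by move=> /andP[t0 t1]; rewrite normrM ger0_norm // ler_piMl.
have [|t tI E] := @mean_value_line f (h *: u + x) e (h * a).
  by move=> t /sle sa; have [] := xr _ (key _ _ hr sa).
have {tI} sa := sle _ tI; set s := t * (h * a) in sa E.
rewrite /g E; have [_ /=] := xr _ (key _ _ hr sa).
rewrite /GRing.scale /= mulrA mulrA mulVf // mul1r -mulrBr normrM => H.
apply: (@le_lt_trans _ _ ((`|a| + 1) * `|'D_e f x - 'D_e f (h *: u + x + s *: e)|)).
  by rewrite ler_wpM2r // lerDl.
by rewrite mulrC -ltr_pdivlMr.
Unshelve. all: by end_near. Qed.

End DirectionalDerivatives.

Section Uniformity.
Variables (R : realType) (V : normedModType R).
Implicit Types (f : V -> R) (K : set V).

Lemma compact_uniform_continuity f K (eta : R) : compact K -> 0 < eta ->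
  (forall x, K x -> {for x, continuous f}) ->
  exists2 delta, 0 < delta &
    forall x y, K x -> `|x - y| < delta -> `|f x - f y| < eta.
Proof.
move=> /compact_near_coveringP cK eta0 cf.
have := cK R (0^'+)%classic
  (fun d x => forall y, `|x - y| < d -> `|f x - f y| < eta) _.
case.
  move=> x Kx; have e2 : 0 < eta / 2 by rewrite divr_gt0.
  have /cvgrPdist_lt/(_ _ e2)/nbhs_ballP[r /= r0 xr] := cf x Kx.
  exists (ball x (r / 2), [set d | 0 < d < r / 2]) => /=.
    split; first by apply: nbhsx_ballx; rewrite divr_gt0.
    near=> d; apply/andP; split; near: d; first exact: nbhs_right_gt.
    by apply: nbhs_right_lt; rewrite divr_gt0.
  move=> [z d] /= [xz /andP[d0 dr]] y zy.
  rewrite -ball_normE /= in xz xr.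
  have H1 : `|f x - f z| < eta / 2 by apply: xr => /=; lra.
  have H2 : `|f x - f y| < eta / 2.
    apply: xr => /=; rewrite -(subrKA z); apply: le_lt_trans (ler_normD _ _) _; lra.
  rewrite -(subrKA (f x)); apply: le_lt_trans (ler_normD _ _) _.
  rewrite distrC; lra.
move=> d /= d0 dK; exists (d / 2) => [|x y Kx]; first by rewrite divr_gt0.
apply: dK => //=; last by rewrite divr_gt0.
by rewrite sub0r normrN ger0_norm ?ltr_pdivrMr ?ltr_pMr ?ltW ?ltr1n // divr_gt0.
Unshelve. all: by end_near. Qed.

Lemma compact_bound f K : compact K ->
  (forall x, K x -> {for x, continuous f}) ->
  exists2 C, 0 < C & forall x, K x -> `|f x| <= C.
Proof.
move=> cK cf.
have /compact_bounded[M [_ MK]] : compact (f @` K).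
  apply: continuous_compact => //; apply: continuous_in_subspaceT => x.
  by rewrite inE => /cf.
exists (`|M| + 1) => [|x Kx]; first by rewrite ltr_wpDl.
by apply: MK; [rewrite (le_lt_trans (ler_norm M)) // ltrDl|exists x].
Qed.
End Uniformity.

Section Partial.
Variables (R : realType) (m : nat).
Local Notation V := 'rV[R]_m.+1.
Implicit Types (f : V -> R) (U : set V).

Lemma is_derive_partial f U x (h : V) : open U -> U x ->
  (forall y i, U y -> derivable f y (delta_mx 0 i)) ->
  (forall i, {for x, continuous (partial i f)}) ->
  is_derive x h f (\sum_i h 0 i * partial i f x).
Proof.
move=> oU Ux df cf.
suff H (r : seq 'I_m.+1) : is_derive x (\sum_(i <- r) h 0 i *: delta_mx 0 i) f
    (\sum_(i <- r) h 0 i * partial i f x).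
  by rewrite [h in is_derive _ h]row_sum_delta; exact: H.
elim: r => [|i r [IH1 IH2]].
  by rewrite !big_nil; split; [exact: derivable0|exact: derive0].
rewrite !big_cons addrC [X in is_derive _ _ _ X]addrC -IH2.
apply: (derivable_add _ _ f x _ _ _ _ (cf i) IH1).
by apply: filterS (open_nbhs_nbhs (conj oU Ux)) => y Uy; exact: df.
Qed.

Lemma near_partial f g U x i : open U -> U x -> (forall y, U y -> f y = g y) ->
  partial i f x = partial i g x.
Proof.
move=> oU Ux fg; apply: near_eq_derive.
by apply: filterS (open_nbhs_nbhs (conj oU Ux)).
Qed.

Lemma near_continuous f g U x : open U -> U x ->
  (forall y, U y -> f y = g y) -> {for x, continuous f} -> {for x, continuous g}.
Proof.
move=> oU Ux fg cf; have E : \forall y \near x, f y = g y.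
  by apply: filterS (open_nbhs_nbhs (conj oU Ux)).
rewrite /prop_for /continuous_at -(fg x) //.
exact: cvg_trans (near_eq_cvg E) cf.
Qed.

Lemma norm_rV_le (x : V) (e : R) : 0 <= e -> (forall j, `|x 0 j| <= e) -> `|x| <= e.
Proof.
move=> e0 xe; rewrite [leLHS]/Num.Def.normr /= mx_normrE; apply/bigmax_leP.
by split=> // -[i j] _; rewrite ord1; exact: xe.
Qed.

Lemma norm_coord_le (x : V) j : `|x 0 j| <= `|x|.
Proof.
by rewrite [leRHS]/Num.Def.normr /= mx_normrE; apply/bigmax_geP; right => /=; exists (0, j).
Qed.

Lemma open_halfspace : open (@halfspace R m).
Proof.
rewrite (_ : @halfspace R m = (fun x : V => x 0 ord0) @^-1` [set r | 0 < r]) //.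
by apply: open_comp => [x _|]; [exact: coord_continuous|exact: open_gt].
Qed.

Lemma closure_halfspace (x : V) : 0 <= x 0 ord0 -> closure (@halfspace R m) x.
Proof.
move=> x0 B /nbhs_ballP[r /= r0 xr].
exists (x + (r / 2) *: delta_mx 0 ord0); split.
  rewrite /halfspace /= !mxE !eqxx /= mulr1 ltr_wpDl // divr_gt0 //.
apply: xr; rewrite -ball_normE /= opprD addNKr normrN.
have r2 : 0 < r / 2 by rewrite divr_gt0.
apply: (@le_lt_trans _ _ (r / 2)); last by rewrite ltr_pdivrMr // ltr_pMr // ltr1n.
apply: norm_rV_le => [|j]; first exact: ltW.
rewrite !mxE eqxx /= normrM gtr0_norm // ler_piMr ?(ltW r2) //.
by case: (j == ord0); rewrite ?normr1 ?normr0.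
Qed.

Definition half_sphere : set V := [set x : V | 0 <= x 0 ord0 /\ `|x| = 1].

Lemma compact_half_sphere : compact half_sphere.
Proof.
apply: bounded_closed_compact.
  by exists 1; split=> // M M1 x [_ x1]; rewrite /= x1 ltW.
apply: closedI.
  apply: (@closed_comp _ _ (fun x : V => x 0 ord0) [set r | 0 <= r]) => [x _|].
    exact: coord_continuous.
  exact: closed_ge.
apply: (@closed_comp _ _ (@Num.Def.normr R V) [set 1]) => [x _|].
  exact: norm_continuous.
exact: closed_eq.
Qed.

Lemma half_sphere_closure : half_sphere `<=` closure (@halfspace R m) `\ 0.
Proof.
move=> x [x0 x1]; split; first exact: closure_halfspace.
by move=> /= x00; move: x1; rewrite x00 normr0 => /esym/eqP; rewrite oner_eq0.
Qed.

Lemma half_sphere_bound (f : V -> R) U : closure (@halfspace R m) `\ 0 `<=` U ->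
  smooth_on U f -> exists2 C, 0 < C & forall x, half_sphere x -> `|f x| <= C.
Proof.
move=> HU sf; apply: compact_bound; first exact: compact_half_sphere.
by move=> x /half_sphere_closure /HU Ux; have [] := sf [::] x Ux.
Qed.

Lemma half_sphere_boundary_bound (f : V -> R) U :
  closure (@halfspace R m) `\ 0 `<=` U -> smooth_on U f ->
  (forall x : V, x 0 ord0 = 0 -> x != 0 -> f x = 0) ->
  exists2 C, 0 < C & forall x (j : 'I_m.+1), j != ord0 -> half_sphere x ->
    `|x 0 j| = 1 -> `|f x| <= C * x 0 ord0.
Proof.
move=> HU sf f0.
have sf0 : smooth_on U (partial ord0 f).
  by move=> s x Ux; have := sf (rcons s ord0) x Ux; rewrite /iter_partial foldr_rcons.
have [C C0 HC] := half_sphere_bound _ _ HU sf0.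
exists C => // x j j0 [x0 x1] xj.
pose s := x 0 ord0; pose y := x - s *: delta_mx 0 ord0.
have yj t : (y + t *: delta_mx 0 ord0) 0 j = x 0 j.
  by rewrite !mxE (negbTE j0) !mulr0 subr0 addr0.
have y0 t : (y + t *: delta_mx 0 ord0) 0 ord0 = t.
  by rewrite !mxE eqxx !mulr1 subrr add0r.
have Ky t : 0 <= t <= s -> half_sphere (y + t *: delta_mx 0 ord0).
  move=> /andP[t0 ts]; split; first by rewrite y0.
  apply/eqP; rewrite eq_le -[X in _ && (X <= _)]xj -(yj t) norm_coord_le andbT.
  apply: norm_rV_le => // k; have [->|k0] := eqVneq k ord0.
    by rewrite y0 ger0_norm // (le_trans ts) // -x1 (le_trans (ler_norm _)) // norm_coord_le.
  rewrite !mxE (negbTE k0) !mulr0 subr0 addr0 -x1; exact: norm_coord_le.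
have [t tI|t tI] := @mean_value_line _ _ f y (delta_mx 0 ord0) s _.
  have : half_sphere (y + (t * s) *: delta_mx 0 ord0).
    by apply: Ky; case/andP: tI => t0 t1; rewrite mulr_ge0 // ler_piMl.
  by move=> /half_sphere_closure /HU Ux; have [_] := sf [::] _ Ux; exact.
have yN0 : y != 0.
  apply/eqP => y00; have := yj 0; rewrite y00 scale0r addr0 mxE => xj0.
  by move: xj; rewrite -xj0 normr0 => /esym/eqP; rewrite oner_eq0.
rewrite /y subrK -/y (f0 y) //; last by have := y0 0; rewrite scale0r addr0.
rewrite subr0 => ->; rewrite normrM ger0_norm // mulrC ler_wpM2r //; apply: HC.
by apply: Ky; case/andP: tI => t0 t1; rewrite mulr_ge0 // ler_piMl.
Qed.
End Partial.

(** * Divergence over grids *)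

Lemma continuous_at_sum (R : realType) (T : topologicalType) (I : Type) (r : seq I)
  (f : I -> T -> R) (x : T) : (forall i, {for x, continuous (f i)}) ->
  {for x, continuous (fun y => \sum_(i <- r) f i y)}.
Proof.
by move=> cf; apply: cvg_big => [|i _]; [exact: add_continuous|exact: cf].
Qed.

Lemma sum_inj_le (R : realType) (I J : finType) (h : I -> J) (f : J -> R) : injective h ->
  (forall j, 0 <= f j) -> \sum_i f (h i) <= \sum_j f j.
Proof.
move=> hi f0; rewrite -(big_imset f (in2W hi)) /=.
by rewrite [leRHS](bigID [in h @: predT]) /= lerDl sumr_ge0.
Qed.

Section Grid.
Variables (R : realType) (n : nat).

Definition set_coord {T : Type} (q : {ffun 'I_n -> T}) (j : 'I_n) (a : T) : {ffun 'I_n -> T} :=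
  [ffun k => if k == j then a else q k].

Definition grid_nat {N : nat} (p : {ffun 'I_n -> 'I_N}) : {ffun 'I_n -> nat} :=
  [ffun k => p k : nat].

(* Summing N times over the grid, (p, i) |-> (p with p_j := i, p_j) is an
   involution, so that p_j may be summed on its own and the sum telescopes. *)
Lemma grid_telescope (N : nat) (G : {ffun 'I_n -> nat} -> R) (j : 'I_n) (M : R) :
  (forall q : {ffun 'I_n -> nat}, (forall k, (q k <= N)%N) ->
     (q j == 0%N) || (q j == N) -> `|G q| <= M) ->
  N%:R * `|\sum_(p : {ffun 'I_n -> 'I_N})
     (G (set_coord (grid_nat p) j (p j).+1) - G (grid_nat p))|
  <= (N ^ n)%:R * (2 * M).
Proof.
move=> GM; pose H (p : {ffun 'I_n -> 'I_N}) :=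
  G (set_coord (grid_nat p) j (p j).+1) - G (grid_nat p).
have E : N%:R * (\sum_p H p) = \sum_(p : {ffun 'I_n -> 'I_N}) \sum_(i < N) H (set_coord p j i).
  rewrite pair_big /=.
  pose h (u : {ffun 'I_n -> 'I_N} * 'I_N) := (set_coord u.1 j u.2, u.1 j).
  have hK : involutive h.
    move=> [p i]; rewrite /h /= /set_coord ffunE eqxx; congr pair.
    by apply/ffunP => k; rewrite !ffunE; case: eqP => // ->.
  rewrite (reindex_inj (can_inj hK)) /=.
  have -> : \sum_(u : {ffun 'I_n -> 'I_N} * 'I_N) H (set_coord (h u).1 j (h u).2) =
      \sum_(u : {ffun 'I_n -> 'I_N} * 'I_N) H u.1.
    by apply: eq_bigr => u _; congr H; have := hK u => /(congr1 fst).
  rewrite -(pair_bigA _ (fun p _ => H p)) /= mulr_sumr; apply: eq_bigr => p _.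
  by rewrite sumr_const card_ord mulr_natl.
rewrite -[N%:R in leLHS]ger0_norm // -normrM E.
apply: le_trans (ler_norm_sum _ _ _) _.
have -> : (N ^ n)%:R * (2 * M) = \sum_(p : {ffun 'I_n -> 'I_N}) (2 * M).
  by rewrite sumr_const card_ffun !card_ord mulr_natl.
apply: ler_sum => p _.
have -> : \sum_(i < N) H (set_coord p j i) =
   \sum_(0 <= i < N) (G (set_coord (grid_nat p) j i.+1) - G (set_coord (grid_nat p) j i)).
  rewrite big_mkord; apply: eq_bigr => i _; congr (G _ - G _).
    by apply/ffunP => k; rewrite !ffunE eqxx; case: eqP.
  by apply/ffunP => k; rewrite !ffunE; case: eqP.
rewrite telescope_sumr // mulr2n mulrDl !mul1r.
apply: le_trans (ler_normB _ _) _.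
have B (a : nat) k : (a <= N)%N -> (set_coord (grid_nat p) j a k <= N)%N.
  by move=> aN; rewrite !ffunE; case: eqP => // _; exact: ltnW.
apply: lerD; apply: GM => [k|]; try exact: B; by rewrite !ffunE !eqxx ?orbT.
Qed.

End Grid.
Arguments set_coord {n T}.
Arguments grid_nat {n N}.

Section Divergence.
Variables (R : realType) (n : nat).
Local Notation V := 'rV[R]_n.+1.

Definition box (L : R) : set V :=
  [set x | x 0 ord0 = 1 /\ forall k : 'I_n, `|x 0 (lift ord0 k)| <= L].

Lemma compact_box L : compact (box L).
Proof.
apply: bounded_closed_compact.
  exists (1 + `|L|); split=> // M LM x [x0 xL]; apply: norm_rV_le => [|j].
    by rewrite (le_trans _ (ltW LM)) // addr_ge0.
  apply: le_trans (ltW LM); case: (unliftP ord0 j) => [k ->|->].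
    by apply: le_trans (xL k) _; rewrite (le_trans (ler_norm _)) // lerDr.
  by rewrite x0 normr1 lerDl.
have -> : box L = (fun x : V => x 0 ord0) @^-1` [set 1] `&`
  \bigcap_(k in [set: 'I_n]) ((fun x : V => `|x 0 (lift ord0 k)|) @^-1` [set r | r <= L]).
  by rewrite eqEsubset; split=> x [? H]; split=> // k; move: (H k) => // /(_ I).
apply: closedI.
  apply: (@closed_comp _ _ (fun x : V => x 0 ord0) [set 1]) => [x _|].
    exact: coord_continuous.
  exact: closed_eq.
apply: closed_bigI => k _.
apply: (@closed_comp _ _ (fun x : V => `|x 0 (lift ord0 k)|) [set r | r <= L]) => [x _|].
  apply: (@continuous_comp _ _ _ (fun x : V => x 0 (lift ord0 k)) Num.Def.normr).
    exact: coord_continuous.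
  exact: norm_continuous.
exact: closed_le.
Qed.

Definition grid_point (L eps : R) (q : {ffun 'I_n -> nat}) : V :=
  \row_k if unlift ord0 k is Some j then eps * (q j)%:R - L else 1.

Lemma grid_point0 L eps q : grid_point L eps q 0 ord0 = 1.
Proof. by rewrite mxE unlift_none. Qed.

Lemma grid_point_lift L eps q j : grid_point L eps q 0 (lift ord0 j) = eps * (q j)%:R - L.
Proof. by rewrite mxE liftK. Qed.

Lemma grid_point_box (L eps : R) (N : nat) (q : {ffun 'I_n -> nat}) :
  0 <= eps -> eps * N%:R = 2 * L ->
  (forall k, (q k <= N)%N) -> box L (grid_point L eps q).
Proof.
move=> e0 eN qN; split; first exact: grid_point0.
move=> k; rewrite grid_point_lift ler_norml.
have H1 : eps * (q k)%:R <= eps * N%:R by rewrite ler_wpM2l // ler_nat.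
have H2 : 0 <= eps * (q k)%:R by rewrite mulr_ge0.
by rewrite eN in H1; apply/andP; split; lra.
Qed.

Variables (F : 'I_n -> V -> R).
Let H := @halfspace R n.
Let DF j := partial (lift ord0 j) (F j).
Hypothesis dF : forall j x, H x -> derivable (F j) x (delta_mx 0 (lift ord0 j)).
Hypothesis cDF : forall j x, H x -> {for x, continuous (DF j)}.

Lemma box_halfspace L x : box L x -> H x.
Proof. by move=> [x0 _]; rewrite /H /halfspace /= x0. Qed.

Lemma grid_divergence (L M eta : R) : 0 < L -> 0 < eta ->
  (forall x j, box L x -> `|x 0 (lift ord0 j)| = L -> `|F j x| <= M) ->
  exists2 e0, 0 < e0 & forall N : nat, (0 < N)%N -> forall eps : R,
   eps < e0 -> eps * N%:R = 2 * L ->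
   \sum_(p : {ffun 'I_n -> 'I_N}) \sum_j DF j (grid_point L eps (grid_nat p))
     <= (N ^ n)%:R * (n%:R * (M / L + eta)).
Proof.
move=> L0 eta0 FM.
have [e0 e00 He] : exists2 e0, 0 < e0 & forall j x y, box L x -> `|x - y| < e0 ->
    `|DF j x - DF j y| < eta.
  have uc j : exists d, 0 < d /\ forall x y, box L x -> `|x - y| < d -> `|DF j x - DF j y| < eta.
    have [|d ? ?] := @compact_uniform_continuity _ _ (DF j) _ _ (compact_box L) eta0.
      by move=> x /box_halfspace; exact: cDF.
    by exists d.
  have [d /all_and2 [d0 dd]] := choice uc.
  exists (\big[Num.min/1]_j d j) => [|j x y bx xy].
    by apply: lt_bigmin => // j _; exact: d0.
  by apply: dd bx _; apply: lt_le_trans xy _; exact: bigmin_le.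
exists e0 => // N N0 eps epse eN.
have NR : 0 < (N%:R : R) by rewrite ltr0n.
have eps0 : 0 < eps by rewrite -(pmulr_lgt0 _ NR) eN mulr_gt0.
have shift q j : grid_point L eps (set_coord q j (q j).+1) =
    grid_point L eps q + eps *: delta_mx 0 (lift ord0 j).
  apply/rowP => k; rewrite !mxE; case: (unliftP ord0 k) => [i ->|->].
    rewrite ffunE (inj_eq lift_inj); case: (eqVneq i j) => [->|_] /=.
      by rewrite mulr1 -natr1; lra.
    by rewrite mulr0 addr0.
  by rewrite (negbTE (neq_lift _ _)) andbF mulr0 addr0.
have main j : \sum_(p : {ffun 'I_n -> 'I_N}) DF j (grid_point L eps (grid_nat p))
    <= (N ^ n)%:R * (M / L + eta).
  pose G q := F j (grid_point L eps q).
  have Gb (q : {ffun 'I_n -> nat}) : (forall k, (q k <= N)%N) ->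
     (q j == 0%N) || (q j == N) -> `|G q| <= M.
    move=> qN qj; apply: FM; first exact: grid_point_box (ltW eps0) eN qN.
    rewrite grid_point_lift; case/orP: qj => /eqP ->.
      by rewrite mulr0 sub0r normrN gtr0_norm.
    by rewrite eN gtr0_norm; lra.
  have T := grid_telescope _ _ N G j M Gb.
  have step (p : {ffun 'I_n -> 'I_N}) : eps * DF j (grid_point L eps (grid_nat p)) <=
      (G (set_coord (grid_nat p) j (p j).+1) - G (grid_nat p)) + eps * eta.
    set x := grid_point _ _ _.
    have bx : box L x.
      by apply: grid_point_box (ltW eps0) eN _ => k; rewrite ffunE; exact: ltnW.
    have near (t : R) : 0 <= t <= 1 -> `|x - (x + (t * eps) *: delta_mx 0 (lift ord0 j))| < e0.
      move=> t01; rewrite opprD addNKr normrN; apply: (@le_lt_trans _ _ eps) => //.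
      case/andP: t01 => t0 t1; apply: norm_rV_le => [|k]; first exact: ltW.
      rewrite !mxE eqxx /= normrM ger0_norm ?mulr_ge0 ?(ltW eps0) //.
      apply: le_trans (ler_wpM2l _ (_ : _ <= 1)) _; first by rewrite mulr_ge0 ?(ltW eps0).
        by case: (k == _); rewrite ?normr1 ?normr0.
      by rewrite mulr1 ler_piMl ?(ltW eps0).
    have [t tI|t tI] := @mean_value_line _ _ (F j) x (delta_mx 0 (lift ord0 j)) eps _.
      apply: dF; rewrite /H /halfspace /= !mxE unlift_none.
      by rewrite (negbTE (neq_lift _ _)) andbF mulr0 addr0.
    have -> : (p j).+1 = (grid_nat p j).+1 by rewrite ffunE.
    rewrite /G shift -/x => ->; rewrite -mulrDr ler_pM2l //.
    have := He j _ _ bx (near t tI); rewrite ltr_norml => /andP[_ /ltW].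
    by rewrite lerBlDr addrC.
  have S : eps * (\sum_(p : {ffun 'I_n -> 'I_N}) DF j (grid_point L eps (grid_nat p))) <=
     `|\sum_(p : {ffun 'I_n -> 'I_N})
     (G (set_coord (grid_nat p) j (p j).+1) - G (grid_nat p))| + (N ^ n)%:R * (eps * eta).
    rewrite mulr_sumr; apply: le_trans (ler_sum _ (fun p _ => step p)) _.
    rewrite big_split /= sumr_const card_ffun !card_ord mulr_natl lerD2r.
    exact: ler_norm.
  rewrite -(ler_pM2l (mulr_gt0 NR eps0)) -mulrA.
  apply: le_trans (ler_wpM2l (ltW NR) S) _; rewrite mulrDr.
  apply: le_trans (lerD T (lexx _)) _.
  have -> : N%:R * eps * ((N ^ n)%:R * (M / L + eta)) =
    (N ^ n)%:R * ((eps * N%:R) * M / L) + N%:R * ((N ^ n)%:R * (eps * eta)) by ring.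
  rewrite eN lerD2r ler_wpM2l // mulrAC mulfK ?gt_eqF //.
rewrite exchange_big /=; apply: le_trans (ler_sum _ (fun j _ => main j)) _.
by rewrite sumr_const card_ord -[leLHS]mulr_natl mulrCA.
Qed.

Let D x := \sum_j DF j x.

Lemma decaying_divergence_eq0 (C : R) : 0 < C ->
  (forall x : V, x 0 ord0 = 1 -> 0 <= D x) ->
  (forall L (x : V) j, 1 <= L -> box L x -> `|x 0 (lift ord0 j)| = L ->
     `|F j x| <= C / L ^+ n) ->
  forall x : V, x 0 ord0 = 1 -> D x = 0.
Proof.
move=> C0 D0 FC x x01; apply/eqP; apply: contraT => DxN0.
have Dx0 : 0 < D x by rewrite lt_def DxN0 D0.
set c := D x / 2; have c0 : 0 < c by rewrite divr_gt0.
have [r r0 xr] : exists2 r, 0 < r & forall y, `|x - y| <= r -> c <= D y.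
  have cD : {for x, continuous D}.
    apply: continuous_at_sum => j; apply: cDF.
    by rewrite /H /halfspace /= x01.
  have /cvgrPdist_lt/(_ _ c0)/nbhs_ballP[r /= r0 xr] := cD.
  exists (r / 2) => [|y xy]; first by rewrite divr_gt0.
  have /xr /= : ball x r y.
    by rewrite -ball_normE /=; apply: le_lt_trans xy _; rewrite ltr_pdivrMr // ltr_pMr // ltr1n.
  by rewrite ltr_norml => /andP[_]; rewrite /c; lra.
pose B := (`|x| + r + 1) / r + (2 / r) ^+ n * n%:R * C / r * 2 / c.
have [q qB] : exists q : nat, B < q%:R by exists (Num.truncn B).+1; exact: truncnS_gt.
have B1 : 0 <= (2 / r) ^+ n * n%:R * C / r * 2 / c.
  have r2 : 0 <= 2 / r by rewrite divr_ge0 // ltW.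
  by rewrite divr_ge0 ?(ltW c0) // mulr_ge0 // divr_ge0 ?(ltW r0) // mulr_ge0 ?(ltW C0) //
    mulr_ge0 // exprn_ge0.
have q0 : 0 < (q%:R : R).
  by apply: le_lt_trans qB; rewrite addr_ge0 // divr_ge0 ?(ltW r0) // !addr_ge0 // ltW.
pose L := q%:R * r.
have Lx : `|x| + r + 1 <= L.
  by rewrite -ler_pdivrMr // ltW // (le_lt_trans _ qB) // lerDl.
have L0 : 0 < L by rewrite mulr_gt0.
have L1 : 1 <= L by apply: le_trans Lx; rewrite lerDr addr_ge0 // ltW.
pose M := C / L ^+ n.
have ML : (2 * q%:R) ^+ n * (n%:R * (M / L)) < c / 2.
  have -> : (2 * q%:R) ^+ n * (n%:R * (M / L)) = (2 / r) ^+ n * n%:R * C / r / q%:R.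
    rewrite /M /L !exprMn exprVn; field.
    by rewrite !gt_eqF // exprn_gt0.
  have : (2 / r) ^+ n * n%:R * C / r * 2 / c < q%:R.
    apply: le_lt_trans qB; rewrite lerDr.
    by rewrite divr_ge0 ?(ltW r0) // !addr_ge0 // ltW.
  by rewrite ltr_pdivrMr // ltr_pdivrMr //; lra.
pose eta := c / 2 / ((2 * q%:R) ^+ n * (n%:R + 1)).
have Z0 : 0 < (2 * q%:R) ^+ n * (n%:R + 1) :> R.
  by rewrite mulr_gt0 ?exprn_gt0 ?mulr_gt0 // ltr_wpDl.
have eta0 : 0 < eta by rewrite !divr_gt0.
have Eeta : (2 * q%:R) ^+ n * (n%:R * eta) < c / 2.
  rewrite mulrA mulrC /eta mulrAC ltr_pdivrMr // ltr_pM2l ?divr_gt0 //.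
  by rewrite ltr_pM2l ?exprn_gt0 ?mulr_gt0 // ltrDl.
have [e0 e00 He0] := grid_divergence L M eta L0 eta0 (fun x j => FC L x j L1).
have [m mB] : exists m : nat, r / e0 < m%:R.
  by exists (Num.truncn (r / e0)).+1; exact: truncnS_gt.
have m0 : 0 < (m%:R : R) by apply: lt_trans mB; rewrite divr_gt0.
pose N := (2 * q * m)%N; pose eps := r / m%:R.
have eps0 : 0 < eps by rewrite divr_gt0.
have epsm : eps * m%:R = r by rewrite divfK // gt_eqF.
have eN : eps * N%:R = 2 * L.
  by rewrite /N !natrM /L -epsm; ring.
have N0 : (0 < N)%N by rewrite !muln_gt0 /= -!(ltr0n R) q0 m0.
have epsr : eps <= r by rewrite ler_pdivrMr // ler_peMr ?(ltW r0) // ler1n -(ltr0n R).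
have epse : eps < e0 by rewrite ltr_pdivrMr // mulrC -ltr_pdivrMr.
have S := He0 N N0 eps epse eN.
pose i0 (j : 'I_n) := Num.truncn ((x 0 (lift ord0 j) + L) / eps).
have xj j : - (L - r) <= x 0 (lift ord0 j) <= L - r.
  rewrite -ler_norml; apply: le_trans (norm_coord_le _ _ _ _) _; lra.
have i0P j : eps * (i0 j)%:R <= x 0 (lift ord0 j) + L < eps * (i0 j)%:R + eps.
  have /andP[xj1 xj2] := xj j.
  have : 0 <= (x 0 (lift ord0 j) + L) / eps by rewrite divr_ge0 ?ltW //; lra.
  move=> /truncn_itv; rewrite -/(i0 j) ler_pdivlMr // ltr_pdivrMr // -natr1 mulrDl mul1r.
  by rewrite [eps * _]mulrC.
have km (k : 'I_m) : eps * k%:R + eps <= r.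
  by rewrite -epsm -[X in _ + X]mulr1 -mulrDr natr1 ler_pM2l // ler_nat.
have bound (j : 'I_n) (k : 'I_m) : (i0 j + k < N)%N.
  rewrite -(ltr_nat R) -(ltr_pM2l eps0) eN natrD mulrDr.
  move: (i0P j) (km k) (xj j); lra.
pose h (p : {ffun 'I_n -> 'I_m}) : {ffun 'I_n -> 'I_N} := [ffun j => Ordinal (bound j (p j))].
have hI : injective h.
  move=> p p' /ffunP E; apply/ffunP => j; apply/val_inj.
  by have := E j; rewrite !ffunE => /(congr1 val) /= /addnI.
have P1 : (m ^ n)%:R * c <= \sum_(p : {ffun 'I_n -> 'I_m}) D (grid_point L eps (grid_nat (h p))).
  have -> : (m ^ n)%:R * c = \sum_(p : {ffun 'I_n -> 'I_m}) c.
    by rewrite sumr_const card_ffun !card_ord mulr_natl.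
  apply: ler_sum => p _; apply: xr; apply: norm_rV_le => [|k]; first exact: ltW.
  rewrite !mxE; case: (unliftP ord0 k) => [j ->|->]; last by rewrite x01 subrr normr0 ltW.
  rewrite !ffunE /= natrD mulrDr ler_norml; apply/andP.
  move: (i0P j) (km (p j)) (mulr_ge0 (ltW eps0) (ler0n R (p j))).
  by split; lra.
have P2 := sum_inj_le _ _ _ h (fun p => D (grid_point L eps (grid_nat p))) hI
   (fun p => D0 _ (grid_point0 _ _ _)).
have := le_trans (le_trans P1 P2) S.
have -> : (N ^ n)%:R * (n%:R * (M / L + eta)) =
  (m ^ n)%:R * ((2 * q%:R) ^+ n * (n%:R * (M / L)) + (2 * q%:R) ^+ n * (n%:R * eta)).
  by rewrite !natrX /N !natrM !exprMn; ring.
rewrite ler_pM2l; last by rewrite natrX exprn_gt0.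
by move: ML Eeta; lra.
Qed.

End Divergence.

(** * Strongly homogeneous forms *)

Section C1.
Variables (R : realType) (m : nat).
Local Notation V := 'rV[R]_m.+1.
Implicit Types (f g : V -> R) (x : V) (U : set V).

Definition C1_on U f := forall x, U x -> {for x, continuous f} /\
  forall i, derivable f x (delta_mx 0 i) /\ {for x, continuous (partial i f)}.

Lemma smooth_partial U f i : smooth_on U f -> smooth_on U (partial i f).
Proof.
by move=> sf s x Ux; have := sf (rcons s i) x Ux; rewrite /iter_partial foldr_rcons.
Qed.

Lemma smooth_C1 U f : smooth_on U f -> C1_on U f.
Proof.
move=> sf x Ux; have [c d] := sf [::] x Ux; split=> // i; split; first exact: d.
by have [] := sf [:: i] x Ux.
Qed.

Lemma partial_cst (c : R) i x : partial i (fun=> c) x = 0.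
Proof. exact: derive_cst. Qed.

Lemma partialM f g x i : derivable f x (delta_mx 0 i) -> derivable g x (delta_mx 0 i) ->
  partial i (fun y => f y * g y) x = f x * partial i g x + g x * partial i f x.
Proof. by move=> df dg; exact: (deriveM df dg). Qed.

Lemma partialZ (c : R) f x i : derivable f x (delta_mx 0 i) ->
  partial i (fun y => c * f y) x = c * partial i f x.
Proof.
move=> df; apply: etrans (partialM (fun=> c) f x i _ df) _; first exact: derivable_cst.
by rewrite (partial_cst c i x) mulr0 addr0.
Qed.

Lemma partialN f x i : derivable f x (delta_mx 0 i) ->
  partial i (fun y => - f y) x = - partial i f x.
Proof. by move=> df; rewrite /partial -[fun y => _]/(- f) deriveN. Qed.

Lemma partialD f g x i : derivable f x (delta_mx 0 i) -> derivable g x (delta_mx 0 i) ->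
  partial i (fun y => f y + g y) x = partial i f x + partial i g x.
Proof. by move=> df dg; rewrite /partial -[fun y => _]/(f + g) deriveD. Qed.

Lemma fun_sumE N (f : 'I_N -> V -> R) : (fun y => \sum_(k < N) f k y) = \sum_(k < N) f k.
Proof. by apply/funext => y; rewrite fct_sumE. Qed.

Lemma derivable_fun_sum N (f : 'I_N -> V -> R) x u : (forall k, derivable (f k) x u) ->
  derivable (fun y => \sum_(k < N) f k y) x u.
Proof. by move=> df; rewrite fun_sumE; exact: derivable_sum. Qed.

Lemma partial_sum N (f : 'I_N -> V -> R) x i :
  (forall k, derivable (f k) x (delta_mx 0 i)) ->
  partial i (fun y => \sum_(k < N) f k y) x = \sum_(k < N) partial i (f k) x.
Proof. by move=> df; rewrite /partial fun_sumE derive_sum. Qed.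

Lemma is_derive_coord (x u : V) a : is_derive x u (fun y : V => y 0 a) (u 0 a).
Proof.
suff C : h^-1 *: (((fun y : V => y 0 a) \o shift x) (h *: u) - x 0 a) @[h --> 0^'] --> u 0 a.
  by split; [apply/cvg_ex; eexists; exact: C | exact: cvg_lim C].
apply: cvg_trans (@cvg_cst _ (u 0 a) _ (0^') _).
apply: near_eq_cvg; near=> h.
have h0 : h != 0 by near: h; exact: nbhs_dnbhs_neq.
by rewrite /= !mxE addrK /GRing.scale /= mulrA mulVf // mul1r.
Unshelve. all: by end_near. Qed.

Lemma C1M U f g : open U -> C1_on U f -> C1_on U g -> C1_on U (fun y => f y * g y).
Proof.
move=> oU cf cg x Ux; have [cfx df] := cf x Ux; have [cgx dg] := cg x Ux; split.
  exact: (continuousM cfx cgx).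
move=> i; split; first by apply: derivableM; [case: (df i)|case: (dg i)].
apply: (@near_continuous _ _ (fun y => f y * partial i g y + g y * partial i f y) _ _ _ oU Ux).
  move=> y Uy; rewrite partialM //; first by have [_ /(_ i)[]] := cf y Uy.
  by have [_ /(_ i)[]] := cg y Uy.
by apply: continuousD; apply: continuousM => //; [case: (dg i)|case: (df i)].
Qed.

Lemma C1_cst U (c : R) : C1_on U (fun=> c).
Proof.
move=> x Ux; split; first exact: cst_continuous.
move=> i; split; first exact: derivable_cst.
have -> : partial i (fun=> c) = fun=> 0 by apply/funext => y; exact: partial_cst.
exact: cst_continuous.
Qed.

Lemma C1_sum U N (f : 'I_N -> V -> R) : open U -> (forall k, C1_on U (f k)) ->
  C1_on U (fun y => \sum_(k < N) f k y).
Proof.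
move=> oU cf x Ux; split.
  by apply: continuous_at_sum => k; have [] := cf k x Ux.
move=> i; have df k y : U y -> derivable (f k) y (delta_mx 0 i).
  by move=> Uy; have [_ /(_ i)[]] := cf k y Uy.
split; first by apply: derivable_fun_sum => k; exact: df.
apply: (@near_continuous _ _ (fun y => \sum_(k < N) partial i (f k) y) _ _ _ oU Ux).
  by move=> y Uy; rewrite partial_sum // => k; exact: df.
by apply: continuous_at_sum => k; have [_ /(_ i)[]] := cf k x Ux.
Qed.

Lemma C1_derive U f x (h : V) : open U -> C1_on U f -> U x ->
  is_derive x h f (\sum_i h 0 i * partial i f x).
Proof.
move=> oU cf Ux; apply: (is_derive_partial _ _ f U) => // [y i Uy|i].
  by have [_ /(_ i)[]] := cf y Uy.
by have [_ /(_ i)[]] := cf x Ux.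
Qed.

Lemma partial_coord_relation U (g1 g2 g3 : V -> R) (a b c i : 'I_m.+1) : open U ->
  C1_on U g1 -> C1_on U g2 -> C1_on U g3 ->
  (forall y : V, U y -> y 0 a * g1 y + y 0 b * g2 y + y 0 c * g3 y = 0) ->
  forall x, U x ->
  (x 0 a * partial i g1 x + (i == a)%:R * g1 x) +
  (x 0 b * partial i g2 x + (i == b)%:R * g2 x) +
  (x 0 c * partial i g3 x + (i == c)%:R * g3 x) = 0.
Proof.
move=> oU c1 c2 c3 E x Ux.
have := near_partial _ _ _ (fun=> 0) _ _ i oU Ux E; rewrite partial_cst => <-.
have dc d : derivable (fun y : V => y 0 d) x (delta_mx 0 i).
  by have [] := is_derive_coord x (delta_mx 0 i) d.
have pc d : partial i (fun y : V => y 0 d) x = (i == d)%:R.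
  by have [_] := is_derive_coord x (delta_mx 0 i) d; rewrite mxE eqxx eq_sym.
have d1 : derivable g1 x (delta_mx 0 i) by have [_ /(_ i)[]] := c1 x Ux.
have d2 : derivable g2 x (delta_mx 0 i) by have [_ /(_ i)[]] := c2 x Ux.
have d3 : derivable g3 x (delta_mx 0 i) by have [_ /(_ i)[]] := c3 x Ux.
have dm d g : derivable g x (delta_mx 0 i) -> derivable (fun y : V => y 0 d * g y) x (delta_mx 0 i).
  by move=> dg; exact: (derivableM (dc d) dg).
rewrite partialD; [|by apply: derivableD; exact: dm|exact: dm].
rewrite partialD; [|exact: dm|exact: dm].
rewrite (partialM _ _ _ _ (dc a) d1) (partialM _ _ _ _ (dc b) d2).
by rewrite (partialM _ _ _ _ (dc c) d3) !pc; ring.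
Qed.
End C1.
Arguments C1_on {R m}.

Lemma bianchi_pair_symmetry (R : realType) (I : Type) (T : I -> I -> I -> I -> R) :
  (forall i j k l, T j i k l = - T i j k l) -> (forall i j k l, T i j l k = - T i j k l) ->
  (forall p j k l, T p j k l + T k j l p + T l j p k = 0) ->
  forall i j k l, T i j k l = T k l i j.
Proof.
move=> Al Ar B i j k l.
move: (B i j k l) (B j i k l) (B k i j l) (B l i j k).
move: (B i k j l) (B i l j k) (B j k i l) (B j l i k).
rewrite !(Al i j, Al i k, Al i l, Al j k, Al j l, Al k l).
rewrite !(Ar _ _ i j, Ar _ _ i k, Ar _ _ i l, Ar _ _ j k, Ar _ _ j l, Ar _ _ k l).
lra.
Qed.

Lemma power_derivative (R : realType) (n : nat) (s D y : R) : (0 < n)%N -> 0 < s ->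
  s * D = (1 - n%:R) * y -> s ^+ n.-1 * D + y * (n.-1%:R * s ^+ n.-1.-1) = 0.
Proof.
case: n => // -[_ s0|n _ s0] /= E.
  move/eqP: E; rewrite subrr mul0r mulf_eq0 gt_eqF //= => /eqP ->.
  by rewrite mulr0 mul0r mulr0 addr0.
have -> : s ^+ n.+1 * D + y * (n.+1%:R * s ^+ n) = s ^+ n * (s * D + n.+1%:R * y).
  by rewrite exprS; ring.
by rewrite E -[n.+2%:R]natr1; ring.
Qed.

Section StronglyHomogeneous.
Variables (R : realType) (n : nat).
Local Notation V := 'rV[R]_n.+1.
Local Notation H := (@halfspace R n).
Variable Om : superform R n.+1.
Hypothesis n_gt0 : (0 < n)%N.
Hypothesis Om_smooth : smooth_form_on H Om.
Hypothesis Om_closed : vanishes_on H (extd Om).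
Hypothesis Om_contract : vanishes_on H (deltasharp Om).

Let T i j k l : V -> R := fun x => dual (Om x) i j k l.
Let oH := open_halfspace R n.

Lemma C1_dual i j k l : C1_on H (T i j k l).
Proof. by apply: C1M => //; [exact: C1_cst|exact/smooth_C1/Om_smooth]. Qed.

Lemma derivable_dual i j k l x p : H x -> derivable (T i j k l) x (delta_mx 0 p).
Proof. by move=> Hx; have [_ /(_ p)[]] := C1_dual i j k l x Hx. Qed.

Lemma div_dual j k l x : H x -> \sum_i partial i (T i j k l) x = 0.
Proof.
move=> Hx; have := congr1
  (fun f : supercov R n.+1 => f (~: [set j], ~: [set k; l])%SET) (Om_closed x Hx).
rewrite extd_dual ffunE => /eqP; rewrite mulf_eq0 signr_eq0 /= => /eqP E.
apply: etrans (etrans (congr1 (fun z => cut_sign R k l * z) E) (mulr0 _)).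
rewrite mulr_sumr; apply: eq_bigr => i _.
rewrite partialM; [|exact: derivable_cst|]; last first.
  by have [_ /(_ i)[]] := smooth_C1 _ _ _ _ (Om_smooth (~: [set i; j])%SET (~: [set k; l])%SET) x Hx.
by rewrite partial_cst mulr0 addr0 ffunE; ring.
Qed.

(* The divergence over i of the relation contract_dual. *)
Lemma bianchi_dual p j k l x : H x ->
  T p j k l x + T k j l p x + T l j p k x = 0.
Proof.
move=> Hx; have cT := C1_dual.
have E i : (x 0 p * partial i (T i j k l) x + (i == p)%:R * T i j k l x) +
  (x 0 k * partial i (T i j l p) x + (i == k)%:R * T i j l p x) +
  (x 0 l * partial i (T i j p k) x + (i == l)%:R * T i j p k x) = 0.
  apply: (partial_coord_relation _ _ H) => // y Hy.
  by apply: contract_dual; exact: Om_contract.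
have S a (f : 'I_n.+1 -> R) : \sum_i (i == a)%:R * f i = f a.
  rewrite (bigD1 a) //= eqxx mul1r big1 ?addr0 // => i /negbTE ->; exact: mul0r.
have := @big1 R 0 +%R _ (index_enum _) predT _ (fun i _ => E i).
rewrite !big_split /= -!mulr_sumr !div_dual // !mulr0 !add0r.
by rewrite (S p (fun i => T i j k l x)) (S k (fun i => T i j l p x)) (S l (fun i => T i j p k x)).
Qed.

Lemma dual_sym i j k l x : H x -> T i j k l x = T k l i j x.
Proof.
move=> Hx; apply: (bianchi_pair_symmetry _ _ (fun i j k l => T i j k l x)).
- by move=> *; exact: dual_antisyml.
- by move=> *; exact: dual_antisymr.
- by move=> *; exact: bianchi_dual.
Qed.

(* By the pair symmetry contract_dual also holds for the first two indices; this
   is its divergence. *)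
Lemma euler_dual i j k l x : H x ->
  \sum_p x 0 p * partial p (T i j k l) x = (1 - n%:R) * T i j k l x.
Proof.
move=> Hx; have cT := C1_dual.
have E p : (x 0 p * partial p (T i j k l) x + (p == p)%:R * T i j k l x) +
  (x 0 i * partial p (T j p k l) x + (p == i)%:R * T j p k l x) +
  (x 0 j * partial p (T p i k l) x + (p == j)%:R * T p i k l x) = 0.
  apply: (partial_coord_relation _ _ H) => // y Hy.
  rewrite (dual_sym i j) // (dual_sym j p) // (dual_sym p i) //.
  by apply: contract_dual; exact: Om_contract.
have S a (f : 'I_n.+1 -> R) : \sum_i (i == a)%:R * f i = f a.
  rewrite (bigD1 a) //= eqxx mul1r big1 ?addr0 // => q /negbTE ->; exact: mul0r.
have D : \sum_p partial p (T j p k l) x = 0.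
  apply: etrans (etrans (congr1 (fun z => - z) (div_dual j k l x Hx)) (oppr0 _)).
  rewrite -sumrN; apply: eq_bigr => p _.
  rewrite -partialN; last exact: derivable_dual.
  by congr partial; apply/funext => y; exact: dual_antisyml.
have := @big1 R 0 +%R _ (index_enum _) predT _ (fun p _ => E p).
under eq_bigr do rewrite eqxx mul1r.
rewrite !big_split /= -!mulr_sumr D div_dual // !mulr0 !add0r.
rewrite (S i (fun p => T j p k l x)) (S j (fun p => T p i k l x)).
have N : cut_sign R i j * cut_sign R k l *
    \sum_(p < n.+1) Om x (~: [set i; j], ~: [set k; l])%SET = (n%:R + 1) * T i j k l x.
  by rewrite mulr_sumr sumr_const card_ord -[LHS]mulr_natl -natr1.
have A : T j i k l x = - T i j k l x by exact: dual_antisyml.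
by rewrite N A; lra.
Qed.

Lemma dual_homogeneous i j k l x t : 1 <= t -> H x ->
  t ^+ n.-1 * T i j k l (t *: x) = T i j k l x.
Proof.
move=> t1 Hx; have Ht s : 0 < s -> H (0 + s *: x).
  by move=> s0; rewrite add0r /halfspace /= mxE mulr_gt0.
pose g (s : R) := s ^+ n.-1 * T i j k l (0 + s *: x).
have dg (s : R) : 0 < s -> is_derive s (1 : R) g 0.
  move=> s0; have [dT ET] := C1_derive _ _ _ _ _ x oH (C1_dual i j k l) (Ht s s0).
  have d1 : is_derive s (1 : R) (fun s => T i j k l (0 + s *: x)) ('D_x (T i j k l) (0 + s *: x)).
    exact: is_derive_line.
  have d2 : is_derive s (1 : R) ((id : R -> R) ^+ n.-1) (n.-1%:R * s ^+ n.-1.-1).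
    by apply: is_derive_eq; rewrite /GRing.scale /= mulr1.
  have -> : g = (id : R -> R) ^+ n.-1 * (fun s => T i j k l (0 + s *: x)) :> (R -> R).
    by apply/funext => r; rewrite /g !fctE.
  apply: is_derive_eq; rewrite exprfctE /GRing.scale /=.
  have sD : s * 'D_x (T i j k l) (0 + s *: x) = (1 - n%:R) * T i j k l (0 + s *: x).
    rewrite ET -euler_dual; last exact: Ht.
    rewrite mulr_sumr; apply: eq_bigr => p _.
    have -> : (0 + s *: x) 0 p = s * x 0 p by rewrite !mxE add0r.
    by rewrite mulrA.
  exact: (power_derivative _ _ _ _ _ n_gt0 s0 sD).
have [s _] : exists2 s, s \in `[1, t]%R & g t - g 1 = (fun=> 0) s * (t - 1).
  apply: MVT_segment => // [s|].
    by rewrite in_itv /= => /andP[s1 _]; apply: dg; exact: lt_trans s1.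
  apply: derivable_within_continuous => s; rewrite in_itv /= => /andP[s1 _].
  by apply: ex_derive; apply: dg; exact: lt_le_trans s1.
rewrite mul0r /g !add0r scale1r expr1n mul1r => /eqP.
by rewrite subr_eq0 => /eqP.
Qed.
End StronglyHomogeneous.

Lemma uniform_constant (R : realType) (J : finType) (P : J -> R -> Prop) :
  (forall j C C', C <= C' -> P j C -> P j C') ->
  (forall j, exists2 C, 0 < C & P j C) ->
  exists2 C, 0 < C & forall j, P j C.
Proof.
move=> mono ex; have /choice[C HC] : forall j, exists C, 0 < C /\ P j C.
  by move=> j; have [C ? ?] := ex j; exists C.
exists (1 + \sum_j C j) => [|j].
  by rewrite ltr_pwDl // sumr_ge0 // => j _; have [/ltW] := HC j.
have [Cj0 Pj] := HC j; apply: mono Pj; rewrite (bigD1 j) //= addrCA lerDl.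
by rewrite addr_ge0 // sumr_ge0 // => k _; have [/ltW] := HC k.
Qed.

Section Scaling.
Variables (R : realType) (n : nat).
Local Notation V := 'rV[R]_n.+1.
Local Notation H := (@halfspace R n).

Lemma halfspaceZ (x : V) (t : R) : 0 < t -> H x -> H (t *: x).
Proof. by move=> t0 Hx; rewrite /halfspace /= mxE mulr_gt0. Qed.

Lemma partial_homogeneous1 (v : V -> R) i (x : V) (t : R) :
  C1_on H v -> homogeneous1 v -> 0 < t -> H x ->
  partial i v (t *: x) = partial i v x.
Proof.
move=> cv hv t0 Hx; have oH := open_halfspace R n.
have [_ E] := C1_derive _ _ _ _ _ (t *: delta_mx 0 i) oH cv (halfspaceZ _ _ t0 Hx).
have S : \sum_k (t *: delta_mx 0 i : V) 0 k * partial k v (t *: x) = t * partial i v (t *: x).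
  rewrite (bigD1 i) //= big1 => [|k /negbTE ki]; last by rewrite !mxE ki mulr0 mul0r.
  by rewrite addr0 !mxE !eqxx mulr1.
have tv : t * partial i v x = t * partial i v (t *: x).
  rewrite -S -E.
  have -> : 'D_(t *: delta_mx 0 i) v (t *: x) = partial i (fun y => v (t *: y)) x.
    rewrite /partial /derive.
    have -> : (fun h : R => h^-1 *: ((v \o shift (t *: x)) (h *: (t *: delta_mx 0 i)) - v (t *: x))) =
      (fun h => h^-1 *: (((fun y => v (t *: y)) \o shift x) (h *: delta_mx 0 i) - v (t *: x))).
      apply/funext => h /=; congr (_ *: (v _ - _)).
      by rewrite scalerDr !scalerA [h * t]mulrC.
    by [].
  have -> : partial i (fun y => v (t *: y)) x = partial i (fun y => t * v y) x.
    by apply: (near_partial _ _ _ _ H) => // y Hy; exact: hv.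
  by rewrite partialZ //; have [_ /(_ i)[]] := cv x Hx.
by apply: (mulfI _ (esym tv)); rewrite gt_eqF.
Qed.

Lemma partial_boundary (w : V -> R) (i : 'I_n.+1) : i != ord0 ->
  (forall x : V, x 0 ord0 = 0 -> x != 0 -> w x = 0) ->
  forall x : V, x 0 ord0 = 0 -> x != 0 -> partial i w x = 0.
Proof.
move=> i0 w0 x x0 xN0; apply: cvg_lim => //.
apply: cvg_trans (@cvg_cst _ (0 : R) _ (0^') _).
have hN : \forall h \near (0 : R)^', h != - x 0 i.
  have [->|xiN0] := eqVneq (x 0 i) 0; first by rewrite oppr0; exact: nbhs_dnbhs_neq.
  have : \forall h \near (0 : R)^', `|h| < `|x 0 i| by apply: dnbhs0_lt; rewrite normr_gt0.
  by apply: filterS => h; apply: contraTneq => ->; rewrite normrN ltxx.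
apply: near_eq_cvg; near=> h; rewrite /= !w0 ?subrr ?scaler0 //.
  by rewrite !mxE x0 eq_sym (negbTE i0) andbF mulr0 addr0.
have hx : h != - x 0 i by near: h.
apply: contraNneq hx => /(congr1 (fun y : V => y 0 i)).
by rewrite !mxE !eqxx mulr1 => /eqP; rewrite addr_eq0.
Unshelve. all: by end_near. Qed.

Lemma box_half_sphere (L : R) (x : V) (j : 'I_n) : 1 <= L -> box R n L x ->
  `|x 0 (lift ord0 j)| = L ->
  [/\ half_sphere R n (L^-1 *: x), `|(L^-1 *: x) 0 (lift ord0 j)| = 1,
      (L^-1 *: x) 0 ord0 = L^-1 & H (L^-1 *: x)].
Proof.
move=> L1 [x0 xL] xj; have L0 : 0 < L by exact: lt_le_trans L1.
have z0 : (L^-1 *: x) 0 ord0 = L^-1 by rewrite mxE x0 mulr1.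
have zj : `|(L^-1 *: x) 0 (lift ord0 j)| = 1.
  by rewrite mxE normrM xj gtr0_norm ?invr_gt0 // mulVf // gt_eqF.
split=> //; last by rewrite /halfspace /= z0 invr_gt0.
split; first by rewrite z0 invr_ge0 ltW.
apply/eqP; rewrite eq_le -{2}zj norm_coord_le andbT.
apply: norm_rV_le => // k; case: (unliftP ord0 k) => [i ->|->].
  rewrite mxE normrM gtr0_norm ?invr_gt0 // mulrC ler_pdivrMr // mul1r; exact: xL.
by rewrite z0 gtr0_norm ?invr_gt0 // invf_le1.
Qed.

Section Bounds.
Variables v w : V -> R.
Hypothesis v_smooth : smooth_on H v.
Hypothesis v_hom : homogeneous1 v.
Hypothesis w_ext : smooth_extension v w.
Hypothesis w_bd : forall x : V, x 0 ord0 = 0 -> x != 0 -> w x = 0.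

Lemma boundary_decay : exists2 C, 0 < C & forall (L : R) (x : V) (j : 'I_n), 1 <= L ->
  box R n L x -> `|x 0 (lift ord0 j)| = L ->
  `|v x| <= C /\ forall k : 'I_n, `|partial (lift ord0 k) v x| <= C / L.
Proof.
have [W [oW HW sw wv]] := w_ext; have oH := open_halfspace R n.
have [C1 C10 H1] := half_sphere_boundary_bound _ _ w W HW sw w_bd.
have [C2 C20 H2] : exists2 C, 0 < C & forall k : 'I_n, forall x (j : 'I_n.+1), j != ord0 ->
    half_sphere R n x -> `|x 0 j| = 1 -> `|partial (lift ord0 k) w x| <= C * x 0 ord0.
  apply: uniform_constant => [k C C' CC' B x j j0 Kx xj|k].
    by apply: le_trans (B x j j0 Kx xj) _; rewrite ler_wpM2r //; case: Kx.
  apply: (half_sphere_boundary_bound _ _ _ W) => //; first exact: smooth_partial.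
  by apply: partial_boundary => //; rewrite eq_sym neq_lift.
exists (C1 + C2) => [|L x j L1 bx xj]; first exact: addr_gt0.
have L0 : 0 < L by exact: lt_le_trans L1.
have [Kz zj z0 Hz] := box_half_sphere L x j L1 bx xj.
have xz : x = L *: (L^-1 *: x) by rewrite scalerA divff ?scale1r // gt_eqF.
have j0 : lift ord0 j != ord0 by rewrite eq_sym neq_lift.
split=> [|k].
  rewrite xz v_hom // -wv // normrM gtr0_norm //.
  apply: le_trans (ler_wpM2l (ltW L0) (H1 _ _ j0 Kz zj)) _.
  by rewrite z0 mulrCA divff ?mulr1 ?lerDl ?(ltW C20) // gt_eqF.
rewrite xz partial_homogeneous1 //; last exact: smooth_C1.
rewrite -(near_partial _ _ _ _ _ _ _ oH Hz wv).
apply: le_trans (H2 k _ _ j0 Kz zj) _; rewrite z0.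
by rewrite ler_wpM2r ?invr_ge0 ?(ltW L0) // lerDr ltW.
Qed.

End Bounds.

Lemma dual_bound (Om : superform R n.+1) : regular_form Om ->
  exists2 C, 0 < C & forall (i j k l : 'I_n.+1) x, half_sphere R n x -> H x ->
    `|dual (Om x) i j k l| <= C.
Proof.
move=> reg.
suff [C C0 HC] : exists2 C, 0 < C & forall u : ('I_n.+1 * 'I_n.+1) * ('I_n.+1 * 'I_n.+1),
    forall x, half_sphere R n x -> H x -> `|dual (Om x) u.1.1 u.1.2 u.2.1 u.2.2| <= C.
  by exists C => // i j k l; exact: (HC ((i, j), (k, l))).
apply: uniform_constant => [u C C' CC' B x Kx Hx|[[i j] [k l]] /=].
  exact: le_trans (B x Kx Hx) CC'.
have [g [W [oW HW sg gE]]] := reg (~: [set i; j])%SET (~: [set k; l])%SET.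
have [C C0 HC] := half_sphere_bound _ _ g W HW sg.
exists ((`|cut_sign R i j * cut_sign R k l| + 1) * C).
  by rewrite mulr_gt0 // ltr_wpDl.
move=> x Kx Hx; rewrite /dual normrM; apply: ler_pM => //; first by rewrite lerDl.
by have := HC x Kx; rewrite gE.
Qed.

End Scaling.

#[local] Opaque partial.

Theorem theorem10p4 (R : realType) (n : nat) (n_gt0 : (0 < n)%N)
  (v : 'rV[R]_n.+1 -> R) (Omega : superform R n.+1)
  (v_smooth : smooth_on (@halfspace R n) v)
  (v_hom : homogeneous1 v)
  (Omega_reg : regular_form Omega)
  (Omega_hom : strongly_homogeneous n.-1 Omega)
  (Omega_pos : strictly_positive_H0 Omega)
  (v_eq : vanishes_on (@halfspace R n) (swedge (ddsharp v) Omega))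
  (w : 'rV[R]_n.+1 -> R) (* the extension of v *)
  (w_ext : smooth_extension v w)
  (w_bd : forall x : 'rV[R]_n.+1, x 0 ord0 = 0 -> x != 0 -> w x = 0) :
  exists c : R, forall x : 'rV[R]_n.+1, @halfspace R n x -> v x = c * x 0 ord0.
Proof.
have [Om_smooth _ Om_closed Om_contract] := Omega_hom.
have oH := open_halfspace R n.
set H := @halfspace R n in v_smooth v_eq oH Om_smooth Om_closed Om_contract *.
have [b Apos] := strictly_positive_dual _ _ _ Omega_pos.
pose A (j k : 'I_n) (x : 'rV[R]_n.+1) : R :=
  (-1) ^+ b * dual (Omega x) ord0 (lift ord0 j) ord0 (lift ord0 k).
pose G (j : 'I_n) x := \sum_(k < n) A j k x * partial (lift ord0 k) v x.
pose F (j : 'I_n) x := v x * G j x.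
have cv : C1_on H v by exact: smooth_C1.
have cdv i : C1_on H (partial i v) by exact/smooth_C1/smooth_partial.
have cA j k : C1_on H (A j k).
  exact: (C1M _ _ _ (fun=> (-1) ^+ b) _ oH (C1_cst _ _ _ _) (C1_dual _ _ _ Om_smooth _ _ _ _)).
have cG j : C1_on H (G j).
  exact: (C1_sum _ _ _ _ _ oH (fun k => C1M _ _ _ _ _ oH (cA j k) (cdv _))).
have cF j : C1_on H (F j) by exact: (C1M _ _ _ _ _ oH cv (cG j)).
have drv f x i : C1_on H f -> H x -> derivable f x (delta_mx 0 i).
  by move=> cf Hx; have [_ /(_ i)[]] := cf x Hx.
have divA k x : H x -> \sum_j partial (lift ord0 j) (A j k) x = 0.
  move=> Hx; have := div_dual _ _ _ Om_smooth Om_closed ord0 ord0 (lift ord0 k) x Hx.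
  rewrite big_ord_recl /=.
  have -> : partial ord0 (fun x => dual (Omega x) ord0 ord0 ord0 (lift ord0 k)) x = 0.
    rewrite -[RHS](partial_cst R n 0 ord0 x); congr partial; apply/funext => y.
    exact: dual_diagl.
  rewrite add0r => E; apply: etrans (etrans (congr1 (fun z => - (-1) ^+ b * z) E) (mulr0 _)).
  rewrite mulr_sumr.
  apply: eq_bigr => j _.
  have -> : A j k = fun y => - (-1) ^+ b * dual (Omega y) (lift ord0 j) ord0 ord0 (lift ord0 k).
    by apply/funext => y; rewrite /A dual_antisyml mulrN mulNr.
  by rewrite partialZ //; apply: drv Hx; exact: C1_dual.
have Av x : H x -> \sum_j \sum_k A j k x * partial (lift ord0 j) (partial (lift ord0 k) v) x = 0.
  move=> Hx; have := congr1
    (fun f : supercov R n.+1 => f (~: [set ord0], ~: [set ord0])%SET) (v_eq x Hx).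
  rewrite /swedge /ddsharp wedge_dual ffunE => /eqP; rewrite mulf_eq0 signr_eq0 /=.
  rewrite big_ord_recl big1 => [|k _]; last by rewrite dual_diagl mulr0.
  rewrite add0r => /eqP E; apply: etrans (etrans (congr1 (fun z => (-1) ^+ b * z) E) (mulr0 _)).
  rewrite mulr_sumr; apply: eq_bigr => j _.
  rewrite [X in _ = _ * X]big_ord_recl.
  rewrite (dual_diagr _ _ (Omega x) ord0 (lift ord0 j) ord0).
  rewrite [X in _ = _ * (X + _)]mulr0.
  rewrite [X in _ = _ * X]add0r [RHS]mulr_sumr.
  apply: eq_bigr => k _.
  rewrite -[RHS]mulrCA.
  by rewrite [RHS]mulrC.
have divF x : H x -> \sum_j partial (lift ord0 j) (F j) x =
    \sum_j \sum_k partial (lift ord0 j) v x * partial (lift ord0 k) v x * A j k x.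
  move=> Hx; pose B j k := A j k x * partial (lift ord0 j) (partial (lift ord0 k) v) x +
    partial (lift ord0 k) v x * partial (lift ord0 j) (A j k) x.
  have dG j : partial (lift ord0 j) (G j) x = \sum_k B j k.
    rewrite partial_sum => [|k]; last by apply: derivableM; exact: drv.
    apply: eq_bigr => k _.
    exact: (partialM _ _ _ _ _ _ (drv _ _ _ (cA j k) Hx) (drv _ _ _ (cdv _) Hx)).
  have dF j : partial (lift ord0 j) (F j) x =
      v x * (\sum_k B j k) + G j x * partial (lift ord0 j) v x.
    rewrite -dG; exact: (partialM _ _ _ _ _ _ (drv _ _ _ cv Hx) (drv _ _ _ (cG j) Hx)).
  under eq_bigr do rewrite dF.
  rewrite big_split /= -mulr_sumr.
  have -> : \sum_j \sum_k B j k = 0.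
    under eq_bigr do rewrite big_split /=.
    rewrite big_split /= Av // add0r exchange_big /= big1 // => k _.
    by rewrite -mulr_sumr divA // mulr0.
  rewrite mulr0 add0r; apply: eq_bigr => j _; rewrite /G mulr_suml.
  by apply: eq_bigr => k _; rewrite mulrAC -mulrA mulrC.
have row (x : 'rV[R]_n.+1) : x 0 ord0 = 1 ->
    x = row_mx (1%:M : 'M[R]_1) (\row_j x 0 (lift ord0 j)) :> 'rV[R]_n.+1.
  move=> x0; apply/rowP => k; case: (unliftP ord0 k) => [j ->|->].
    have -> : lift ord0 j = rshift 1 j by apply: val_inj.
    apply: esym; apply: etrans (row_mxEr (1%:M : 'M[R]_1) (\row_j x 0 (lift ord0 j)) 0 j) _.
    by rewrite mxE; congr (x _ _); apply: val_inj.
  have -> : ord0 = lshift n (ord0 : 'I_1) by apply: val_inj.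
  apply: esym; apply: etrans (row_mxEl (1%:M : 'M[R]_1) (\row_j x 0 (lift ord0 j)) 0 ord0) _.
  by rewrite mxE eqxx -x0; congr (x _ _); apply: val_inj.
have pos (x : 'rV[R]_n.+1) : x 0 ord0 = 1 -> (\row_j partial (lift ord0 j) v x : 'rV[R]_n) != 0 ->
    0 < \sum_j \sum_k partial (lift ord0 j) v x * partial (lift ord0 k) v x * A j k x.
  move=> x0 a0; have := Apos (\row_j x 0 (lift ord0 j)) _ a0; rewrite -row //.
  by under eq_bigr do under eq_bigr do rewrite !mxE.
have pos0 (x : 'rV[R]_n.+1) : (\row_j partial (lift ord0 j) v x : 'rV[R]_n) = 0 ->
    forall j, partial (lift ord0 j) v x = 0.
  by move=> /rowP E j; have := E j; rewrite !mxE.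
have H1 (x : 'rV[R]_n.+1) : x 0 ord0 = 1 -> H x by move=> x0; rewrite /H /halfspace /= x0.
have [C C0 HC] := boundary_decay _ _ v w v_smooth v_hom w_ext w_bd.
have [B B0 HB] := dual_bound _ _ _ Omega_reg.
have D0 : forall x : 'rV[R]_n.+1, x 0 ord0 = 1 -> \sum_j partial (lift ord0 j) (F j) x = 0.
  apply: (@decaying_divergence_eq0 _ _ F _ _ (C * (n%:R * (B * C)))).
  - by move=> j x Hx; exact: drv.
  - by move=> j x Hx; have [_ /(_ (lift ord0 j))[]] := cF j x Hx.
  - by rewrite !mulr_gt0 // ltr0n.
  - move=> x x0; rewrite divF; last exact: H1.
    have [/pos0 E|/(pos x x0)/ltW //] := eqVneq (\row_j partial (lift ord0 j) v x : 'rV[R]_n) 0.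
    by rewrite big1 // => j _; rewrite big1 // => k _; rewrite E !mul0r.
  - move=> L x j L1 bx xj; have [vC dvC] := HC L x j L1 bx xj.
    have L0 : 0 < L by exact: lt_le_trans L1.
    have [Kz _ _ Hz] := box_half_sphere _ _ L x j L1 bx xj.
    have xz : x = L *: (L^-1 *: x) by rewrite scalerA divff ?scale1r // gt_eqF.
    have AB k : `|A j k x| <= B / L ^+ n.-1.
      rewrite normrM normrX normrN1 expr1n mul1r ler_pdivlMr ?exprn_gt0 //.
      rewrite -[L ^+ _]gtr0_norm ?exprn_gt0 // -normrM mulrC {1}xz.
      rewrite (dual_homogeneous _ _ _ n_gt0 Om_smooth Om_closed Om_contract) //.
      exact: HB.
    rewrite normrM -mulrA; apply: ler_pM => //.
    have -> : n%:R * (B * C) / L ^+ n = \sum_(k < n) (B / L ^+ n.-1 * (C / L)).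
      have -> : L ^+ n = L ^+ n.-1 * L by rewrite -exprSr prednK.
      rewrite sumr_const card_ord -[RHS]mulr_natl; field.
      by rewrite expf_neq0 gt_eqF.
    apply: le_trans (ler_norm_sum _ _ _) _; apply: ler_sum => k _.
    by rewrite normrM; apply: ler_pM.
have dv0 (x : 'rV[R]_n.+1) : x 0 ord0 = 1 -> forall j, partial (lift ord0 j) v x = 0.
  move=> x0; apply: pos0; apply/eqP; apply: contraT => /(pos x x0).
  by rewrite -divF ?D0 ?ltxx //; exact: H1.
pose e : 'rV[R]_n.+1 := delta_mx 0 ord0.
have v1 (x : 'rV[R]_n.+1) : x 0 ord0 = 1 -> v x = v e.
  move=> x0; have e0 : e 0 ord0 = 1 by rewrite mxE !eqxx.
  have l0 t : (e + t *: (x - e)) 0 ord0 = 1 by rewrite !mxE x0 !eqxx subrr mulr0 addr0.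
  have dl t := C1_derive _ _ _ _ _ (x - e) oH cv (H1 _ (l0 t)).
  have [t tI|t _] := @mean_value_line _ _ v e (x - e) 1 _; first by case: (dl (t * 1)).
  rewrite scale1r [e + _]addrC subrK mul1r; have [_ ->] := dl (t * 1).
  rewrite big_ord_recl big1 => [|j _]; last by rewrite dv0 ?mulr0 // l0.
  by rewrite !mxE x0 !eqxx subrr mul0r addr0 => /eqP; rewrite subr_eq0 => /eqP.
exists (v e) => x Hx; have x0 : 0 < x 0 ord0 by [].
have {1}-> : x = x 0 ord0 *: ((x 0 ord0)^-1 *: x) by rewrite scalerA divff ?scale1r // gt_eqF.
rewrite v_hom //; last by apply: halfspaceZ => //; rewrite invr_gt0.
rewrite (v1 ((x 0 ord0)^-1 *: x)); first exact: mulrC.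
by rewrite mxE mulVf // gt_eqF.
Qed.
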